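(* Let $k$ be an algebraically closed field of characteristic $0$, let $N\ge 1$ and $\beta\geq 1$ be integers. Let $I$ be the defining ideal of either $\binom{\beta+N-1}{N}$ very general points in $\mathbb{P}_k^N$ or $\binom{\beta+N-1}{N}$ generic points in $\mathbb{P}^N_{k(\underline z)}$. Then for all $m\geq 1$ $$I^{(Nm)}\subseteq M^{m(N-1)}I^m,$$ where $M=(x_0,\ldots,x_N)$ is the homogeneous maximal ideal of the polynomial ring containing $I$ (that is, $k[x_0,\ldots,x_N]$ in the case of very general points and $k(\underline z)[x_0,\ldots,x_N]$ in the case of generic points).
   Context: For a finite set $X$ of distinct points of projective $N$-space over a field, with homogeneous coordinate ring $A$, the defining ideal $I_X\subseteq A$ is generated by all homogeneous polynomials vanishing on $X$; symbolic powers are $I^{(m)}=\bigcap_{p\in \mathrm{Ass}(A/I)}(I^mA_p\cap A)$ (so $I_X^{(m)}=\bigcap_{P\in X}I(P)^m$, where $I(P)$ is the ideal of the point $P$). Generic points: for $n\ge1$, $k(\underline z)$ is the purely transcendental extension of $k$ obtained by adjoining $n(N+1)$ variables $\underline z=(z_{ij})$, $1\le i\le n$, $0\le j\le N$; the $n$ generic points are $P_i=[z_{i0}:\cdots:z_{iN}]\in\mathbb{P}^N_{k(\underline z)}$, with defining ideal $\bigcap_{i=1}^n I(P_i)$. Very general points: let $G(1,n,N+1)\cong \mathrm{Sym}^n(\mathbb{P}_k^N)=(\mathbb{P}^N_k)^n/S_n$ be the Chow variety of $0$-cycles of degree $n$ in $\mathbb{P}_k^N$. A property $\mathcal{P}$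 holds for $n$ very general points in $\mathbb{P}_k^N$ if there is a nonempty subset $W\subseteq G(1,n,N+1)$ of the form $W=\bigcap_{i=1}^\infty U_i$, with each $U_i$ a dense Zariski-open subset, such that $\mathcal{P}$ holds for every set $X=\{p_1,\ldots,p_n\}$ of $n$ (distinct) points with $p_1+\cdots+p_n\in W$. *)

(* Defs.v *)
From HB Require Import structures.
From mathcomp Require Import all_boot all_order all_algebra.
From mathcomp Require Import finmap mpoly.

Set Implicit Arguments.
Unset Strict Implicit.
Unset Printing Implicit Defensive.

Import GRing.Theory.

Local Open Scope ring_scope.
Local Open Scope quotient_scope.

Section Ideals.

Variable A : comNzRingType.
Implicit Types (I J p S : A -> Prop) (m : nat).

Definition is_ideal I : Prop :=
  [/\ I 0, forall f g, I f -> I g -> I (f + g) & forall a f, I f -> I (a * f)].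

Definition is_prime p : Prop :=
  [/\ is_ideal p, ~ p 1 & forall f g, p (f * g) -> p f \/ p g].

Definition ideal_sub I J : Prop := forall f, I f -> J f.

Definition ideal_gen S : A -> Prop := fun f =>
  exists s : seq (A * A),
    (forall c, c \in s -> S c.2) /\ f = \sum_(c <- s) c.1 * c.2.

Definition ideal_mul I J : A -> Prop :=
  ideal_gen (fun h => exists f g, [/\ I f, J g & h = f * g]).

Definition ideal_pow I m : A -> Prop :=
  iter m (ideal_mul I) (fun _ => True).

(* p is an associated prime of A/I: the annihilator of the class of some g. *)
Definition is_assoc_prime I p : Prop :=
  is_prime p /\ exists g : A, forall f, p f <-> I (f * g).

(* J A_p \cap A, the preimage of the extended ideal under A -> A_p. *)
Definition local_contract J p : A -> Prop := fun f =>
  exists s : A, ~ p s /\ J (s * f).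

Definition symbolic_pow I m : A -> Prop := fun f =>
  forall p, is_assoc_prime I p -> local_contract (ideal_pow I m) p f.

End Ideals.

Definition max_ideal (K : fieldType) (N : nat) : {mpoly K[N.+1]} -> Prop :=
  ideal_gen (fun f => exists i : 'I_N.+1, f = 'X_i).

Arguments max_ideal K N : clear implicits.

(* Points of projective N-space over K: the lines through 0 in K^(N+1). *)
Definition pspace (K : fieldType) (N : nat) : choiceType :=
  {U : {vspace 'rV[K]_N.+1} | \dim U == 1}.

(* [v_0 : ... : v_N] *)
Definition pt (K : fieldType) (N : nat) (v : 'rV[K]_N.+1) (hv : v != 0) :
    pspace K N :=
  exist (fun U : {vspace 'rV[K]_N.+1} => \dim U == 1) <[v]>%VS
    (introT eqP (etrans (dim_vline v) (congr1 nat_of_bool hv))).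

(* A choice of homogeneous coordinates.  Only (multi)homogeneous polynomials
   are tested for vanishing below, so the choice does not matter. *)
Definition hcoord (K : fieldType) (N : nat) (P : pspace K N) : 'rV[K]_N.+1 :=
  vpick (val P).

Definition vanishes_at (K : fieldType) (N : nat) (F : {mpoly K[N.+1]})
    (P : pspace K N) : Prop :=
  F.@[hcoord P 0] = 0.

Definition defining_ideal (K : fieldType) (N : nat) (X : {fset pspace K N}) :
    {mpoly K[N.+1]} -> Prop :=
  ideal_gen (fun F => (exists d : nat, F \is d.-homog) /\
                      (forall P, P \in X -> vanishes_at F P)).

Definition point_ideal (K : fieldType) (N : nat) (P : pspace K N) :
    {mpoly K[N.+1]} -> Prop :=
  defining_ideal [fset P]%fset.

Section ZeroCycles.

Variables (k : fieldType) (N n : nat).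

Local Notation P := (pspace k N).

(* The coordinate ring of (P^N)^n has one variable for each pair (i, j), with
   i < n and j <= N, namely 'X_(mxvec_index i j). *)
Definition multihomog (F : {mpoly k[n * N.+1]}) : Prop :=
  exists d : 'I_n -> nat, forall m, m \in msupp F ->
    forall i : 'I_n, (\sum_(j < N.+1) m (mxvec_index i j))%N = d i.

Definition tuple_coord (t : n.-tuple P) : 'rV[k]_(n * N.+1) :=
  mxvec (\matrix_(i < n) hcoord (tnth t i)).

(* Zariski-open subsets of (P^N)^n: complements of the common zero loci of
   sets of multihomogeneous polynomials. *)
Definition open_prod (U : n.-tuple P -> Prop) : Prop :=
  exists S : {mpoly k[n * N.+1]} -> Prop,
    (forall F, S F -> multihomog F) /\
    (forall t, U t <-> exists F, S F /\ F.@[tuple_coord t 0] != 0).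

Definition same_cycle (s t : n.-tuple P) : bool := perm_eq s t.

Lemma same_cycle_refl : reflexive same_cycle.
Proof. by move=> s; exact: perm_refl. Qed.

Lemma same_cycle_sym : ssrbool.symmetric same_cycle.
Proof. by move=> s t; exact: perm_sym. Qed.

Lemma same_cycle_trans : transitive same_cycle.
Proof. by move=> s t u; exact: perm_trans. Qed.

Canonical same_cycle_equiv :=
  EquivRel same_cycle same_cycle_refl same_cycle_sym same_cycle_trans.

(* Sym^n(P^N) = (P^N)^n / S_n; its elements are the effective 0-cycles of
   degree n. *)
Definition sym_prod : choiceType := {eq_quot same_cycle}.

(* p_1 + ... + p_n *)
Definition cycle_of (t : n.-tuple P) : sym_prod := \pi_{eq_quot same_cycle} t.

(* The quotient topology. *)
Definition open_sym (U : sym_prod -> Prop) : Prop :=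
  open_prod (fun t => U (cycle_of t)).

Definition dense_sym (U : sym_prod -> Prop) : Prop :=
  forall V : sym_prod -> Prop, open_sym V -> (exists c, V c) ->
    exists c, U c /\ V c.

Definition holds_very_general (Q : {fset P} -> Prop) : Prop :=
  exists U : nat -> sym_prod -> Prop,
    [/\ forall i, open_sym (U i) /\ dense_sym (U i),
        exists c, forall i, U i c
      & forall t : n.-tuple P, uniq t -> (forall i, U i (cycle_of t)) ->
          Q [fset p in tval t]%fset].

End ZeroCycles.

Arguments holds_very_general k N n Q : clear implicits.

Section GenericPoints.

Variables (k : fieldType) (N n : nat).

(* k(z), with z_ij = 'X_(mxvec_index i j). *)
Definition gen_field : fieldType := {fraction {mpoly k[n * N.+1]}}.

Definition gen_coord (i : 'I_n) : 'rV[gen_field]_N.+1 :=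
  \row_(j < N.+1) tofrac ('X_(mxvec_index i j) : {mpoly k[n * N.+1]}).

Lemma gen_coord_neq0 (i : 'I_n) : gen_coord i != 0.
Proof.
apply/eqP => /rowP /(_ 0) /eqP; rewrite !mxE tofrac_eq0.
by move/eqP/(congr1 (fun p => p@_(U_(mxvec_index i 0))))/eqP;
  rewrite mcoeffX mcoeff0 eqxx oner_eq0.
Qed.

Definition gen_point (i : 'I_n) : pspace gen_field N := pt (gen_coord_neq0 i).

Definition gen_ideal : {mpoly gen_field[N.+1]} -> Prop := fun f =>
  forall i : 'I_n, point_ideal (gen_point i) f.

End GenericPoints.

Arguments gen_ideal k N n : clear implicits.

(* Main.v *)
From HB Require Import structures.
Require Import Defs.
From mathcomp Require Import all_boot all_order all_algebra.
From mathcomp Require Import fingroup perm.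
From mathcomp Require Import finmap mpoly zify ring.
From Stdlib Require Import Classical.

(* Put [beta = b + 1], let [F] be a form in [I^(Nm)] and assume that the points
   impose independent conditions on forms of degree [b] and avoid [x_0 = 0].

   Degree bound (Chudnovsky): [F = 0] unless [deg F >= m (b + N)].  For the star
   configuration of the N-wise intersections of [b + N] hyperplanes in general
   position this follows by induction on flats: a form vanishing to high order
   along the hyperplane sections of a flat restricts to zero on a general line
   of the flat, by counting roots.  The bound is the nonvanishing of minors that
   are multihomogeneous in the coordinates of the points, so it passes to the
   generic points, and for each [m] to a dense open set of cycles; the star
   configuration itself lies in all these open sets.

   Containment: no form of degree [b] vanishes at the points, so [I] is generated
   in degree [b + 1] by lifts [G_u = u + x_0 (...)] of the monomials [u] in
   [x_1, ..., x_N].  Euler's relation and forms separating the points give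
   [x_0^e F] in [I^m] for some [e].  In degrees at least [m (b + 1)] one may
   cancel [x_0]: because [x_i G_(x_j s) - x_j G_(x_i s)] lies in [x_0 I], a product
   [G_(u_1) ... G_(u_m) w] with [w] nonconstant depends modulo [x_0 I^m] only on
   the monomial [u_1 ... u_m w], so that relations between such products come
   from relations between monomials.  Hence [F] is a combination of products of
   [m] of the [G_u] with coefficients of degree at least [m (N - 1)]. *)

Set Implicit Arguments.
Unset Strict Implicit.
Unset Printing Implicit Defensive.

Import GRing.Theory.

Local Open Scope ring_scope.

Lemma mnm_neq0 n (m : 'X_{1..n}) : m != 0%MM -> exists i, (U_(i) <= m)%MM.
Proof.
move=> m0; case: (pickP (fun i => m i != 0%N)) => [i mi|m_0].
  by exists i; rewrite lep1mP.
case/eqP: m0; apply/mnmP => i; rewrite mnm0E.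
by have /negbFE/eqP := m_0 i.
Qed.

Lemma meval_at0 (R : comNzRingType) n (f : {mpoly R[n]}) : f.@[fun _ => 0] = f@_0.
Proof.
elim/mpolyind: f => [|c m f _ _ IHf]; first by rewrite meval0 mcoeff0.
rewrite mevalD mcoeffD IHf mevalZ mcoeffZ mevalX mcoeffX; congr (_ * _ + _).
case: (altP (m =P 0%MM)) => [->|/mnm_neq0 [i mi]].
  by rewrite big1 // => i _; rewrite mnm0E expr0.
by rewrite (bigD1 i) //= expr0n; move: mi; rewrite lep1mP => /negPf ->; rewrite mul0r.
Qed.

(** * Order of vanishing and restriction to lines *)

Section VanishingOrder.

Variables (K : fieldType) (n : nat).
Implicit Types (f g s : {mpoly K[n]}) (v : 'I_n -> K) (r : nat).

(* In characteristic 0 this says that [f] lies in the r-th power of the maximal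
   ideal of the point [v] of affine space. *)
Fixpoint vord r v f : Prop :=
  if r is r'.+1 then f.@[v] = 0 /\ (forall i, vord r' v f^`M(i)) else True.

Lemma vordD r v f g : vord r v f -> vord r v g -> vord r v (f + g).
Proof.
elim: r f g => [//|r IHr] f g /= [f0 Df] [g0 Dg].
split=> [|i]; first by rewrite mevalD f0 g0 addr0.
by rewrite mderivD; apply: IHr.
Qed.

Lemma vord0 r v : vord r v 0.
Proof. by elim: r => [//|r IHr] /=; split=> [|i]; rewrite ?meval0 ?mderiv0. Qed.

Lemma vordZ r v c f : vord r v f -> vord r v (c *: f).
Proof.
elim: r f => [//|r IHr] f /= [f0 Df].
split=> [|i]; first by rewrite mevalZ f0 mulr0.
by rewrite mderivZ; apply: IHr.
Qed.

Lemma vordN r v f : vord r v f -> vord r v (- f).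
Proof. by move=> hf; rewrite -scaleN1r; apply: vordZ. Qed.

Lemma vord_sum r v (J : Type) (t : seq J) (P : pred J) (F : J -> {mpoly K[n]}) :
  (forall j, P j -> vord r v (F j)) -> vord r v (\sum_(j <- t | P j) F j).
Proof.
by move=> hF; apply: (big_ind (vord r v)) => //; [apply: vord0|apply: vordD].
Qed.

Lemma vordW r v f : vord r.+1 v f -> vord r v f.
Proof.
elim: r f => [//|r IHr] f [f0 Df]; split=> // i.
exact/IHr/Df.
Qed.

Lemma vord_leq r q v f : (q <= r)%N -> vord r v f -> vord q v f.
Proof.
move=> le_qr; rewrite -(subnK le_qr); elim: (r - q)%N => [//|k IHk].
by rewrite addSn => /vordW.
Qed.

Lemma vord_mull r v g f : vord r v f -> vord r v (g * f).
Proof.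
elim: r f g => [//|r IHr] f g hf; have [f0 Df] := hf; split=> [|i].
  by rewrite mevalM f0 mulr0.
by rewrite mderivM; apply: vordD; apply: IHr; [apply: vordW | apply: Df].
Qed.

Lemma vord_mulS r v f g : f.@[v] = 0 -> vord r v g -> vord r.+1 v (f * g).
Proof.
elim: r f g => [|r IHr] f g f0 hg; split=> [|i] //; try by rewrite mevalM f0 mul0r.
rewrite mderivM; apply: vordD; first exact: vord_mull.
exact: IHr f0 (proj2 hg i).
Qed.

(** A polynomial that is nonzero at [v] is a local unit: by Leibniz's rule [s] times a derivative of
    [f] is the derivative of [s * f] minus a multiple of [f], and induction applies. *)
Lemma vord_cancel r v s f : s.@[v] != 0 -> vord r v (s * f) -> vord r v f.
Proof.
move=> s0; elim: r f => [//|r IHr] f sf; have [e Dsf] := sf.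
have fr : vord r v f by apply/IHr/vordW.
split=> [|i].
  by move/eqP: e; rewrite mevalM mulf_eq0 (negPf s0) => /eqP.
apply: IHr; have := Dsf i; rewrite mderivM => h.
have -> : s * f^`M(i) = s^`M(i) * f + s * f^`M(i) + - (s^`M(i) * f).
  by rewrite addrC addrA addNr add0r.
by apply: vordD h _; apply: vordN; apply: vord_mull.
Qed.

Lemma vord_derivm r v f :
  vord r v f <-> forall a : 'X_{1..n}, (mdeg a < r)%N -> f^`M[a].@[v] = 0.
Proof.
elim: r f => [//|r IHr] f /=; split=> [[f0 Df] a|H].
  case: (altP (a =P 0%MM)) => [-> _|a0]; first by rewrite mderivm0m.
  have [i ai] := mnm_neq0 a0.
  have /IHr D := Df i.
  move=> le_ar; have e : a = (U_(i) + (a - U_(i)))%MM by rewrite addmC submK.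
  rewrite e mderivmDm mderivmU1m; apply: D.
  by move: le_ar; rewrite {1}e mdegD mdeg1 add1n ltnS.
split=> [|i]; first by rewrite -(mderivm0m f); apply: H; rewrite mdeg0.
apply/IHr => a ha; rewrite -mderivmU1m -mderivmDm; apply: H.
by rewrite mdegD mdeg1 add1n ltnS.
Qed.

Lemma vord_eq r v v' f : v =1 v' -> vord r v f -> vord r v' f.
Proof.
move=> e; elim: r f => [//|r IHr] f [f0 Df].
by split=> [|i]; [rewrite -(meval_eq _ e)|apply/IHr/Df].
Qed.

Lemma vord_ideal_pow (I : {mpoly K[n]} -> Prop) r v f :
  (forall g, I g -> g.@[v] = 0) -> ideal_pow I r f -> vord r v f.
Proof.
move=> I0; elim: r f => [//|r IHr] f [s [hs ->]].
rewrite big_seq; apply: vord_sum => c /hs [g [h [gI hI ->]]].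
by apply: vord_mull; apply: vord_mulS; [apply: I0|apply: IHr].
Qed.

End VanishingOrder.

Lemma mpoly_alg_ind (R : comNzRingType) (n : nat) (P : {mpoly R[n]} -> Prop) :
  (forall c, P c%:MP) -> (forall i, P 'X_i) ->
  (forall f g, P f -> P g -> P (f + g)) -> (forall f g, P f -> P g -> P (f * g)) ->
  forall f, P f.
Proof.
move=> PC PX PD PM f; rewrite (mpolyE f).
apply: (big_ind P) => [||m _]; [by rewrite -mpolyC0|exact: PD|].
rewrite -mul_mpolyC; apply: (PM) => //; rewrite mpolyXE_id.
apply: (big_ind P) => [||i _]; [by rewrite -mpolyC1|exact: PM|].
elim: (m i) => [|k IHk]; first by rewrite expr0 -mpolyC1.
by rewrite exprS; apply: (PM).
Qed.

(** * Restriction of a polynomial to a parametrized line *)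

Section Lines.

Variables (K : fieldType) (n : nat).
Implicit Types (f g : {mpoly K[n]}) (v w : 'I_n -> K).

Definition line v w : {mpoly K[n]} -> {poly K} :=
  mmap polyC (fun i => (v i)%:P + w i *: 'X).

HB.instance Definition _ v w := GRing.RMorphism.on (line v w).

Lemma lineC v w c : line v w c%:MP = c%:P.
Proof. exact: mmapC. Qed.

Lemma lineX v w i : line v w 'X_i = (v i)%:P + w i *: 'X.
Proof. by rewrite /line mmapX mmap1U. Qed.

Lemma line_horner v w f t : (line v w f).[t] = f.@[fun i => v i + t * w i].
Proof.
rewrite /line /mmap mevalE horner_sum; apply: eq_bigr => m _.
rewrite hornerM hornerC; congr (_ * _).
rewrite /mmap1 horner_prod; apply: eq_bigr => i _.
by rewrite horner_exp !hornerE mulrC.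
Qed.

Lemma size_line v w f : (size (line v w f) <= msize f)%N.
Proof.
rewrite /line /mmap; apply: (leq_trans (size_sum _ _ _)).
rewrite big_seq; apply/bigmax_leqP_seq => m mf _.
rewrite mul_polyC; apply: (leq_trans (size_scale_leq _ _)).
apply: leq_trans (msize_mdeg_lt mf).
rewrite /mmap1; apply: leq_trans (size_prod_leq _ _) _.
rewrite leq_subLR addnS ltnS mdegE.
have h i : (size (((v i)%:P + w i *: 'X) ^+ m i)%R <= (m i).+1)%N.
  apply: (leq_trans (size_poly_exp_leq _ _)); rewrite ltnS.
  rewrite -[leqRHS]mul1n leq_mul2r; apply/orP; right.
  have : (size ((v i)%:P + w i *: 'X)%R <= 2)%N.
    rewrite addrC; apply: leq_trans (size_polyD _ _) _; rewrite geq_max.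
    rewrite (leq_trans (size_scale_leq _ _)) ?size_polyX //=.
    exact: leq_trans (size_polyC_leq1 _) _.
  by case: (size _) => [|[|[]]].
apply: (@leq_trans (\sum_i (m i).+1)%N); first by apply: leq_sum => i _.
by under eq_bigr => i _ do rewrite -addn1; rewrite big_split /= sum1_card addnC.
Qed.

Lemma deriv_line v w f :
  (line v w f)^`() = \sum_i w i *: line v w f^`M(i).
Proof.
elim/mpoly_alg_ind: f => [c|i|f g IHf IHg|f g IHf IHg].
- by rewrite lineC derivC big1 // => i _; rewrite mderivC rmorph0 scaler0.
- rewrite lineX derivD derivC add0r derivZ derivX (bigD1 i) //= big1 ?addr0.
    by rewrite mderivX mnm1E eqxx scale1r -{1}[U_(i)%MM]add0m addmK mpolyX0 rmorph1.
  move=> j ji; rewrite mderivX mnm1E eq_sym (negPf ji) scale0r.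
  by rewrite rmorph0 scaler0.
- rewrite rmorphD derivD IHf IHg -big_split; apply: eq_bigr => i _.
  by rewrite mderivD rmorphD scalerDr.
- rewrite rmorphM derivM IHf IHg mulr_suml mulr_sumr -big_split.
  apply: eq_bigr => i _; rewrite mderivM rmorphD !rmorphM scalerDr.
  by rewrite scalerAl scalerAr.
Qed.

End Lines.

(** * Multiplicities and root counting in characteristic 0 *)

Section CharZero.

Variables (K : fieldType) (K0 : [pchar K] =i pred0).

Lemma natrS_neq0 k : k.+1%:R != 0 :> K.
Proof. by have /pcharf0P -> := K0. Qed.

Lemma natr_inj : injective (fun k : nat => k%:R : K).
Proof.
suff le_inj (i j : nat) : i%:R = j%:R :> K -> (j <= i)%N.
  by move=> i j e; apply/eqP; rewrite eqn_leq !le_inj.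
move=> e; rewrite leqNgt; apply/negP => lt_ij.
have := subnKC lt_ij; rewrite addSnnS => ej.
by have /eqP := e; rewrite -ej natrD -subr_eq0 opprD addrA subrr sub0r oppr_eq0
  (negPf (natrS_neq0 _)).
Qed.

Lemma exists_nat_nonroot (p : {poly K}) : p != 0 -> exists k : nat, p.[k%:R] != 0.
Proof.
move=> p0; have := max_poly_roots (rs := [seq k%:R | k <- iota 0 (size p)]) p0.
rewrite size_map size_iota ltnn (map_inj_uniq natr_inj) iota_uniq.
have [allr /(_ isT isT) //|/allPn [_ /mapP [k _ ->] pk] _] := boolP (all _ _).
by exists k; move: pk; rewrite rootE.
Qed.

Lemma poly_nat_roots (p : {poly K}) : (forall k : nat, p.[k%:R] = 0) -> p = 0.
Proof.
move=> p0; apply/eqP; apply: contraT => /exists_nat_nonroot [k].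
by rewrite p0 eqxx.
Qed.

(** Restriction to coordinate lines shows that the partial derivatives vanish everywhere too. A
    nonzero integer times a coefficient of [f] is a coefficient of a derivative, so induction on the
    degree of the monomial applies. *)
Lemma meval_eq0 n (f : {mpoly K[n]}) : (forall v, f.@[v] = 0) -> f = 0.
Proof.
move=> f0; apply/mpolyP => m; rewrite mcoeff0.
have [d] := ubnP (mdeg m); elim: d => [//|d IHd] in f m f0 *; rewrite ltnS => md.
case: (altP (m =P 0%MM)) => [->|m0]; first by rewrite -meval_at0.
have [i mi] := mnm_neq0 m0.
have Df0 v : (f^`M(i)).@[v] = 0.
  have l0 : line v (fun j => (j == i)%:R) f = 0.
    by apply: poly_nat_roots => k; rewrite line_horner f0.
  have := deriv_line v (fun j => (j == i)%:R) f.
  rewrite l0 deriv0 (bigD1 i) //= eqxx scale1r big1 ?addr0; last first.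
    by move=> j ji; rewrite (negPf ji) scale0r.
  move/(congr1 (horner^~ 0)); rewrite horner0 line_horner => ->.
  by apply: meval_eq => j; rewrite mul0r addr0.
have em : m = (m - U_(i) + U_(i))%MM by rewrite submK.
have md' : (mdeg (m - U_(i))%MM < d)%N by move: md; rewrite {1}em mdegD mdeg1 addn1.
have /eqP := IHd _ _ Df0 md'.
by rewrite mcoeff_mderiv -em -mulr_natr mulf_eq0 (negPf (natrS_neq0 _)) orbF => /eqP.
Qed.

Lemma deriv_root_dvdp (p : {poly K}) t r :
  p.[t] = 0 -> ('X - t%:P) ^+ r %| p^`() -> ('X - t%:P) ^+ r.+1 %| p.
Proof.
move=> pt dp; case: (altP (p =P 0)) => [->|p0]; first exact: dvdp0.
have [m [q]] := multiplicity_XsubC p t; rewrite p0 /= => qt ep.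
case: (leqP r.+1 m) => [le_rm|].
  by rewrite ep dvdp_mull // dvdp_exp2l.
case: m ep => [|m] ep; first by case/negP: qt; apply/rootP; rewrite -pt ep mulr1.
rewrite ltnS => lt_mr; case/negP: qt; rewrite root_factor_theorem.
have h : ('X - t%:P) ^+ m.+1 %| p^`() by apply: dvdp_trans dp; rewrite dvdp_exp2l.
have h2 : ('X - t%:P) ^+ m.+1 %| q^`() * ('X - t%:P) ^+ m.+1 by rewrite dvdp_mull.
move: h; rewrite ep derivM deriv_exp derivXsubC mul1r (dvdp_addr _ h2) /=.
rewrite -mulr_natr mulrCA exprSr dvdp_mul2l ?expf_neq0 ?polyXsubC_eq0 //.
by rewrite -polyC_natr mulrC mul_polyC dvdpZr ?natrS_neq0.
Qed.

Lemma vord_line_dvdp n r v w t (f : {mpoly K[n]}) :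
  vord r (fun i => v i + t * w i) f -> ('X - t%:P) ^+ r %| line v w f.
Proof.
elim: r f => [|r IHr] f; first by rewrite expr0 dvd1p.
case=> f0 Df; apply: deriv_root_dvdp; first by rewrite line_horner.
rewrite deriv_line; apply: (big_ind (fun p => _ %| p)) => [|p q|i _].
- exact: dvdp0.
- exact: dvdp_add.
- by rewrite -mul_polyC; apply/dvdp_mull/IHr/Df.
Qed.

(** The restriction has degree below [r * size ts] but is divisible by the pairwise coprime powers
    [('X - t%:P) ^+ r]. *)
Lemma line_eq0 n r v w (ts : seq K) (f : {mpoly K[n]}) :
  uniq ts -> (forall t, t \in ts -> vord r (fun i => v i + t * w i) f) ->
  (msize f <= r * size ts)%N -> line v w f = 0.
Proof.
move=> uts hts sz.
have dv : \prod_(t <- ts) ('X - t%:P) ^+ r %| line v w f.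
  elim: ts uts hts {sz} => [|t ts IHts] /=; first by rewrite big_nil dvd1p.
  case/andP=> tts uts hts; rewrite big_cons Gauss_dvdp.
    rewrite vord_line_dvdp; last by apply: hts; rewrite mem_head.
    by apply: IHts => // s sts; apply: hts; rewrite inE sts orbT.
  apply/coprimep_expl; rewrite big_seq; apply: (big_ind (coprimep _)) => [|p q hp hq|s sts].
  - exact: coprimep1.
  - by rewrite coprimepMr hp.
  - apply: coprimep_expr; rewrite coprimep_XsubC root_XsubC.
    by apply: contraNneq tts => <-.
apply/eqP; apply: contraLR dv => l0.
apply/negP => /(dvdp_leq l0); apply/negP; rewrite -ltnNge.
have -> : \prod_(t <- ts) ('X - t%:P) ^+ r = (\prod_(t <- ts) ('X - t%:P)) ^+ r.
  by rewrite prodrXl.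
apply: (leq_ltn_trans (leq_trans (size_line _ _ _) sz)).
have := size_exp (\prod_(t <- ts) ('X - t%:P)) r.
rewrite size_prod_XsubC /= mulnC => <-; rewrite prednK // size_poly_gt0.
by rewrite expf_neq0 // monic_neq0 // monic_prod_XsubC.
Qed.

End CharZero.

Section Homogeneous.

Variables (K : fieldType) (n : nat).
Implicit Types (F : {mpoly K[n]}) (v : 'I_n -> K).

Lemma dhomog_mderiv d F i : F \is d.-homog -> F^`M(i) \is d.-1.-homog.
Proof.
move=> /dhomogP hF; apply/dhomogP => m.
rewrite mcoeff_msupp mcoeff_mderiv => h.
have /hF <- : (m + U_(i))%MM \in msupp F.
  by rewrite mcoeff_msupp; apply: contraNneq h => ->; rewrite mul0rn.
by rewrite /= mdegD mdeg1 addn1.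
Qed.

Lemma meval_scale d F c v :
  F \is d.-homog -> F.@[fun i => c * v i] = c ^+ d * F.@[v].
Proof.
move=> /dhomogP hF; rewrite !mevalE mulr_sumr big_seq [RHS]big_seq.
apply: eq_bigr => m /hF /= dm; rewrite mulrCA; congr (_ * _).
rewrite -dm mdegE -prodrXr -big_split; apply: eq_bigr => i _ /=.
by rewrite exprMn.
Qed.

Lemma vord_scale r d F c v :
  F \is d.-homog -> vord r v F -> vord r (fun i => c * v i) F.
Proof.
elim: r d F => [//|r IHr] d F hF [f0 Df].
split=> [|i]; first by rewrite (meval_scale _ _ hF) f0 mulr0.
exact: IHr (dhomog_mderiv i hF) (Df i).
Qed.

Lemma vord_mderivm r v F a : vord r v F -> vord (r - mdeg a) v F^`M[a].
Proof.
move=> /vord_derivm hF; apply/vord_derivm => a' ha'.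
by rewrite -mderivmDm hF // mdegD -ltn_subRL.
Qed.

Lemma msize_mderivm F a : (msize F^`M[a] <= msize F - mdeg a)%N.
Proof.
rewrite msizeE; apply/bigmax_leqP_seq => m.
rewrite mcoeff_msupp mcoeff_mderivm => h _.
have /msize_mdeg_lt : (a + m)%MM \in msupp F.
  by rewrite mcoeff_msupp; apply: contraNneq h => ->; rewrite mul0rn.
by rewrite mdegD -ltn_subRL.
Qed.

Lemma dhomog_msize_leq d F : F \is d.-homog -> (msize F <= d.+1)%N.
Proof.
move=> /dhomogP hF; rewrite msizeE; apply/bigmax_leqP_seq => m mF _.
by rewrite -(hF _ mF).
Qed.

End Homogeneous.

Definition no_form (K : fieldType) (N d r n : nat) (v : 'I_n -> 'I_N.+1 -> K) :=
  forall F : {mpoly K[N.+1]},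
    F \is d.-homog -> (forall i, vord r (v i) F) -> F = 0.

(** * Star configurations *)

Section StarConfiguration.

Variables (K : fieldType) (K0 : [pchar K] =i pred0) (N s : nat).
Variables (a : 'I_s -> K) (a_inj : injective a).
Implicit Types (T : {set 'I_s}) (F : {mpoly K[N.+1]}) (p : {poly K}).

(** Points of projective space are encoded as polynomials of degree at most [N]. Then [p.[a j] = 0]
    is a hyperplane, distinct nodes give general position, and [N] of the hyperplanes meet in the
    point [node_poly T]. *)
Definition coefs p : 'I_N.+1 -> K := fun i => p`_i.

Definition node_poly T : {poly K} := \prod_(j in T) ('X - (a j)%:P).

Lemma size_node_poly T : size (node_poly T) = #|T|.+1.
Proof.
by rewrite /node_poly -big_filter size_prod_XsubC cardE.
Qed.

Lemma node_poly_neq0 T : node_poly T != 0.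
Proof. by rewrite -size_poly_gt0 size_node_poly. Qed.

Lemma node_polyU1 T j : j \notin T ->
  node_poly (j |: T) = ('X - (a j)%:P) * node_poly T.
Proof. by move=> jT; rewrite /node_poly big_setU1. Qed.

(* The polynomials divisible by [node_poly T] form the flat of codimension
   [#|T|] on which the hyperplanes [p.[a j] = 0], [j \in T], meet. *)
Definition vord_flat r T F := forall p,
  (size p <= N.+1)%N -> node_poly T %| p -> vord r (coefs p) F.

(** For [p = h * node_poly T], the line through [p] in the direction [(c - 'X) * node_poly T] stays
    in the flat of [T] and meets the hyperplane of [j] at the parameter [- h.[a j] / (c - a j)]. A
    general [c] makes these parameters finite and distinct. *)
Lemma exists_pencil T (h : {poly K}) :
  (forall j, j \notin T -> h.[a j] != 0) ->
  exists c : K, (forall j, j \notin T -> c - a j != 0) /\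
    {in ~: T &, injective (fun j => - h.[a j] / (c - a j))}.
Proof.
move=> h0.
(* The roots of [B] are the bad values of [c]: the nodes outside [T], and the values at which two
   parameters agree, in cross-multiplied form. *)
pose B := \prod_(j in ~: T) ('X - (a j)%:P) *
  \prod_(i in ~: T) \prod_(j in ~: T | j != i)
     (h.[a j] *: ('X - (a i)%:P) - h.[a i] *: ('X - (a j)%:P)).
have B0 : B != 0.
  rewrite mulf_neq0 //; apply/prodf_neq0 => i; rewrite inE => iT.
    by rewrite polyXsubC_eq0.
  apply/prodf_neq0 => j /andP [_ ji].
  apply: contraNneq (h0 _ iT) => /(congr1 (horner^~ (a i))).
  rewrite !hornerE subrr mulr0 sub0r => /eqP; rewrite oppr_eq0 mulf_eq0.
  by rewrite subr_eq0 (inj_eq a_inj) [i == j]eq_sym (negPf ji) orbF.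
have [k Bk] := exists_nat_nonroot K0 B0; exists k%:R.
move: Bk; rewrite hornerM mulf_eq0 negb_or !horner_prod => /andP [/prodf_neq0 c0 /prodf_neq0 c1].
split=> [j jT|i j iT jT e].
  by have := c0 j; rewrite inE jT !hornerE; apply.
apply/eqP; apply: contraT => ij; have := c1 i iT; rewrite horner_prod => /prodf_neq0 /(_ j).
rewrite jT eq_sym ij !hornerE => /(_ isT) /negP [].
have ci : k%:R - a i != 0 by have := c0 i iT; rewrite !hornerE.
have cj : k%:R - a j != 0 by have := c0 j jT; rewrite !hornerE.
move/eqP: e; rewrite eqr_div // mulNr mulNr eqr_opp => /eqP e.
by rewrite e subrr.
Qed.

(** A derivative of order [mdeg x < q] has order [q' - mdeg x] on each hyperplane section of the
    flat. A general line of the flat meets [s - #|T|] sections, so the root count makes the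
    derivative vanish along it. *)
Lemma vord_flat_step T q q' F :
  (#|T| < N)%N -> (forall j, j \notin T -> vord_flat q' (j |: T) F) ->
  (forall x, (x < q)%N -> msize F - x <= (q' - x) * (s - #|T|))%N ->
  vord_flat q T F.
Proof.
move=> TN hF hq p sp dvd_p; apply/vord_derivm => x hx.
set G := F^`M[x].
have G_flat j : j \notin T -> vord_flat (q' - mdeg x) (j |: T) G.
  by move=> jT p' sp' dp'; apply/vord_mderivm/(hF j).
have mG : (msize G <= (q' - mdeg x) * (s - #|T|))%N.
  exact: leq_trans (msize_mderivm _ _) (hq _ hx).
case: (posnP (q' - mdeg x)) => [q0|q_gt0].
  by move: mG; rewrite q0 leqn0 mmeasure_poly_eq0 => /eqP ->; rewrite meval0.
have G0 p' j : j \notin T -> (size p' <= N.+1)%N -> node_poly (j |: T) %| p' ->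
    G.@[coefs p'] = 0.
  by move=> jT sp' dp'; have := G_flat j jT p' sp' dp'; case: (_ - _)%N q_gt0 => // r _ [].
have /dvdpP [h ep] := dvd_p.
(* If [h] vanishes at a node outside [T], then [p] itself lies on a hyperplane section. *)
have [[j jT /eqP hj]|h0] := altP (@exists_inP _ (fun j => j \notin T) (fun j => h.[a j] == 0)).
  apply: (G0 p j) => //; rewrite node_polyU1 // ep dvdp_mul2r ?node_poly_neq0 //.
  by rewrite dvdp_XsubCl; apply/rootP.
have {}h0 j : j \notin T -> h.[a j] != 0.
  by move=> jT; apply: contraNN h0 => hj; apply/exists_inP; exists j.
have [c [c0 c_inj]] := exists_pencil h0.
pose p' := (c%:P - 'X) * node_poly T.
have sp' : (size p' <= N.+1)%N.
  apply: leq_trans (size_polyMleq _ _) _; rewrite size_node_poly addnS /=.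
  rewrite -opprB size_polyN size_XsubC; exact: TN.
pose tau j := - h.[a j] / (c - a j).
have l0 : line (coefs p) (coefs p') G = 0.
  apply: (line_eq0 K0 (r := q' - mdeg x) (ts := [seq tau j | j in ~: T])).
  - rewrite map_inj_in_uniq ?enum_uniq // => i j; rewrite !mem_enum; exact: c_inj.
  - move=> _ /imageP [j jT ->]; rewrite inE in jT.
    apply: (@vord_eq _ _ _ (coefs (p + tau j *: p'))).
      by move=> i; rewrite /coefs coefD coefZ.
    apply: (G_flat j) => //.
      apply: leq_trans (size_polyD _ _) _; rewrite geq_max sp.
      exact: leq_trans (size_scale_leq _ _) sp'.
    rewrite node_polyU1 // ep /p' scalerAl -mulrDl.
    rewrite dvdp_mul2r ?node_poly_neq0 // dvdp_XsubCl; apply/rootP.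
    by rewrite !hornerE /tau divfK ?c0 // subrr.
  - by rewrite size_map -cardE cardsCs setCK card_ord.
have := congr1 (horner^~ 0) l0; rewrite line_horner horner0 => <-.
by apply: meval_eq => i; rewrite mul0r addr0.
Qed.

(** Here the flat is a single projective point: a multiple of [node_poly T] of degree at most [N] is
    a scalar multiple, and homogeneity absorbs the scalar. *)
Lemma vord_flat_base r d F T : F \is d.-homog -> #|T| = N ->
  vord r (coefs (node_poly T)) F -> vord_flat r T F.
Proof.
move=> hF cT h p sp /dvdpP [q ep].
have [q0|q0] := eqVneq q 0.
  apply: (@vord_eq _ _ _ (fun i => 0 * coefs (node_poly T) i)).
    by move=> i; rewrite /coefs ep q0 !mul0r coef0.
  exact: vord_scale hF h.
have sq : (size q <= 1)%N.
  move: sp; rewrite ep size_mul ?node_poly_neq0 // size_node_poly cT.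
  by rewrite addnS -[N.+1]add1n leq_add2r.
apply: (@vord_eq _ _ _ (fun i => q`_0 * coefs (node_poly T) i)).
  by move=> i; rewrite /coefs ep (size1_polyC sq) coefCM coefC.
exact: vord_scale hF h.
Qed.

(** [q t] is the order along the flats of codimension [t]. The descent runs from the given points,
    [t = N], to the whole space, [t = 0], where positive order means that [F] vanishes
    everywhere. *)
Lemma vord_flat_descent d r (q : nat -> nat) F : F \is d.-homog ->
  (forall T, #|T| = N -> vord r (coefs (node_poly T)) F) ->
  (q N <= r)%N -> (0 < q 0)%N ->
  (forall t x, (t < N)%N -> (x < q t)%N -> (d.+1 - x <= (q t.+1 - x) * (s - t))%N) ->
  F = 0.
Proof.
move=> hF F_r qN q0 hq.
have flat T : (#|T| <= N)%N -> vord_flat (q #|T|) T F.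
  have [k] := ubnP (N - #|T|); elim: k T => // k IHk T; rewrite ltnS => kT TN.
  case: (ltngtP #|T| N) TN => // [TN|TN] _; last first.
    by apply: (vord_flat_base hF TN); rewrite TN; apply: vord_leq qN (F_r _ TN).
  apply: (vord_flat_step (q' := q #|T|.+1)) => // [j jT|x hx].
    have cU : #|j |: T| = #|T|.+1 by rewrite cardsU1 jT.
    by rewrite -cU; apply: IHk; rewrite cU //; lia.
  by apply: leq_trans (hq _ _ TN hx); rewrite leq_sub2r // dhomog_msize_leq.
apply: (meval_eq0 K0) => v.
have := flat set0; rewrite cards0 => /(_ isT (\poly_(i < N.+1) v (inord i))).
case: (q 0) q0 => // r' _ h.
have [||h0 _] := h.
- exact: size_poly.
- by rewrite /node_poly big_set0 dvd1p.
rewrite -h0; apply: meval_eq => i.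
by rewrite /coefs coef_poly ltn_ord inord_val.
Qed.

End StarConfiguration.

Lemma star_exists (K : fieldType) (N b : nat) :
  [pchar K] =i pred0 -> (0 < N)%N ->
  exists v : 'I_('C(b + N, N)) -> 'I_N.+1 -> K,
    [/\ forall i, v i 0 != 0, no_form b 1 v
      & forall m, (0 < m)%N -> no_form (m * (b + N)).-1 (N * m) v].
Proof.
(* The nodes are nonzero, so each [node_poly] has a nonzero constant coefficient and the points
   avoid [x_0 = 0]. *)
move=> K0 N0; pose a (j : 'I_(b + N)) : K := j.+1%:R.
have a_inj : injective a by move=> i j /(natr_inj K0) [] /val_inj.
pose D := [set T : {set 'I_(b + N)} | #|T| == N].
have cD : #|D| = 'C(b + N, N) by rewrite card_draws card_ord.
pose v (i : 'I_('C(b + N, N))) : 'I_N.+1 -> K :=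
  coefs (node_poly a (enum_val (cast_ord (esym cD) i))).
have v_onto (T : {set 'I_(b + N)}) : #|T| = N -> exists i, v i = coefs (node_poly a T).
  move=> cT; have TD : T \in D by rewrite inE cT.
  by exists (cast_ord cD (enum_rank_in TD T)); rewrite /v cast_ordK enum_rankK_in.
exists v; split=> [i|F hF Fv|m m0 F hF Fv].
- rewrite /v /coefs -horner_coef0 horner_prod; apply/prodf_neq0 => j _.
  by rewrite hornerXsubC sub0r oppr_eq0 natrS_neq0.
- apply: (vord_flat_descent K0 a_inj (r := 1) (q := fun=> 1%N) hF) => // [T cT|t x tN].
    by have [i <-] := v_onto T cT; apply: Fv.
  by case: x => // _; rewrite !subn0 mul1n; lia.
(* The extra 1 in [m * t + 1] makes the order at [t = 0] positive. Order [m * t.+1] in codimension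
   [t.+1] suffices for the step, with equality in the root count at [x = m * t]. *)
- apply: (vord_flat_descent K0 a_inj (r := N * m)
    (q := fun t => if (t < N)%N then (m * t).+1 else (N * m)%N) hF).
  + by move=> T cT; have [i <-] := v_onto T cT; apply: Fv.
  + by rewrite ltnn.
  + by rewrite N0.
  move=> t x tN; rewrite tN ltnS => hx.
  have -> : (m * (b + N)).-1.+1 = (m * (b + N))%N by rewrite prednK // muln_gt0 m0 addn_gt0 N0 orbT.
  apply: (@leq_trans ((m * t.+1 - x) * (b + N - t))); last first.
    rewrite leq_mul2r leq_sub2r ?orbT //; case: ifP => [_|]; first exact: leqnSn.
    move=> h; have -> : t.+1 = N by lia. by rewrite mulnC.
  have [w ew] : exists w, (b + N = t + w.+1)%N by exists (b + N - t).-1; lia.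
  have [y ey] : exists y, (m * t = x + y)%N by exists (m * t - x)%N; lia.
  have -> : (b + N - t = w.+1)%N by lia.
  rewrite ew mulnDr (mulnS m t) (mulnS m w) ey.
  have -> : (m + (x + y) - x = m + y)%N by lia.
  have -> : (x + y + (m + m * w) - x = m + m * w + y)%N by lia.
  by rewrite mulnDl mulnS leq_add2l leq_pmulr.
Qed.

(** * Semicontinuity *)

Section ConditionMatrix.

Variables (N d r n : nat).

Local Notation monomial := {m : 'X_{1..N.+1 < d.+1} | mdeg m == d}.
Local Notation condition := ('I_n * 'X_{1..N.+1 < r})%type.
Local Notation p := #|{: monomial}|.
Local Notation q := #|{: condition}|.

(** The value at the point [c.1] of the derivative of order [c.2] of the monomial [m]. The ring is
    arbitrary so that the points may have variables as coordinates. *)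
Definition condition_entry (R : comNzRingType) (z : 'M[R]_(n, N.+1))
    (c : condition) (m : monomial) : R :=
  (\prod_j (val m j) ^_ (c.2 j))%:R * \prod_j z c.1 j ^+ (val m j - c.2 j).

Definition condition_mx (R : comNzRingType) (z : 'M[R]_(n, N.+1)) : 'M[R]_(q, p) :=
  \matrix_(i, j) condition_entry z (enum_val i) (enum_val j).

Definition condition_minor (R : comNzRingType) (z : 'M[R]_(n, N.+1))
    (f : {ffun 'I_p -> 'I_q}) : R := \det (rowsub f (condition_mx z)).

Lemma condition_minor_map (R R' : comNzRingType) (phi : {rmorphism R -> R'})
    (z : 'M[R]_(n, N.+1)) f :
  phi (condition_minor z f) = condition_minor (map_mx phi z) f.
Proof.
rewrite /condition_minor -det_map_mx; congr (\det _); apply/matrixP => i j.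
rewrite !mxE rmorphM rmorph_nat (rmorph_prod phi); congr (_ * _).
by apply: eq_bigr => l _; rewrite rmorphXn mxE.
Qed.

Section Field.

Variable K : fieldType.
Implicit Types (z : 'M[K]_(n, N.+1)) (F : {mpoly K[N.+1]}).

Lemma homog_sum_monomials F : F \is d.-homog ->
  F = \sum_(m : monomial) F@_(val m) *: 'X_[val m].
Proof.
move=> hF; apply/mpolyP => m; rewrite raddf_sum /=.
have [dm|dm] := eqVneq (mdeg m) d; last first.
  rewrite (dhomog_nemf_coeff hF dm) big1 // => m' _; rewrite mcoeffZ mcoeffX.
  have [e|_] := eqVneq (val (val m')) m; last by rewrite mulr0.
  by case/eqP: dm; rewrite -e; apply/eqP/(valP m').
have mb : (mdeg m < d.+1)%N by rewrite dm.
have hm : mdeg (BMultinom mb) == d by rewrite /= dm.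
rewrite (bigD1 (Sub (BMultinom mb) hm : monomial)) //= mcoeffZ mcoeffX eqxx mulr1.
rewrite big1 ?addr0 // => m' /eqP mm'; rewrite mcoeffZ mcoeffX.
have [e|_] := eqVneq (val (val m')) m; last by rewrite mulr0.
by case: mm'; apply/val_inj/val_inj.
Qed.

Lemma condition_mx_eval z F i (a : 'X_{1..N.+1 < r}) : F \is d.-homog ->
  F^`M[a].@[fun j => z i j] =
  \sum_(m : monomial) condition_entry z (i, a) m * F@_(val m).
Proof.
move=> /homog_sum_monomials {1}->; rewrite !raddf_sum; apply: eq_bigr => m _ /=.
rewrite mderivmZ mevalZ mderivmX mevalZ mevalX mulrC; congr (_ * _ * _).
by apply: eq_bigr => j _; rewrite mnmBE.
Qed.

Definition form_coefs F : 'cV[K]_p := \col_j F@_(val (enum_val j : monomial)).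

Lemma vord_condition_mx z F : F \is d.-homog ->
  (forall i, vord r (fun j => z i j) F) <->
  condition_mx z *m form_coefs F = 0.
Proof.
move=> hF; split=> [ordF|/colP h i].
  apply/colP => c; rewrite !mxE.
  pose ic := enum_val c; have /vord_derivm/(_ (val ic.2) (bmdeg _)) := ordF ic.1.
  rewrite (condition_mx_eval _ _ _ hF) => e; rewrite -[RHS]e.
  rewrite [RHS](reindex_onto enum_val enum_rank) => [|m _]; last by rewrite enum_rankK.
  apply: eq_big => [j|j _]; first by rewrite enum_valK eqxx.
  by rewrite !mxE /ic; case: (enum_val c).
apply/vord_derivm => a ha; rewrite -[a]/(val (BMultinom ha)) (condition_mx_eval _ _ _ hF).
have := h (enum_rank (i, BMultinom ha)); rewrite !mxE => e; rewrite -[RHS]e.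
rewrite (reindex_onto enum_val enum_rank) => [|m _]; last by rewrite enum_rankK.
apply: eq_big => [j|j _]; first by rewrite enum_valK eqxx.
by rewrite !mxE enum_rankK.
Qed.

(** The forms satisfying all conditions are the kernel of the condition matrix, so their absence
    means full column rank. *)
Lemma no_form_minor z :
  no_form d r (fun i j => z i j) <-> exists f, condition_minor z f != 0.
Proof.
split=> [nf|[f fz] F hF ordF].
  have fullA : row_full (condition_mx z).
    rewrite -cokermx_eq0; apply/eqP/matrixP => i j; rewrite [RHS]mxE.
    set B := cokermx _; pose F := \sum_k B k j *: 'X_[val (enum_val k : monomial)].
    have hF : F \is d.-homog.
      apply: rpred_sum => k _; apply: rpredZ; rewrite dhomogX; exact: (valP (enum_val k)).
    have cF k : F@_(val (enum_val k : monomial)) = B k j.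
      rewrite raddf_sum (bigD1 k) //= mcoeffZ mcoeffX eqxx mulr1 big1 ?addr0 // => k' kk'.
      rewrite mcoeffZ mcoeffX; case: eqP => [/val_inj/val_inj/enum_val_inj e|_].
        by rewrite e eqxx in kk'.
      by rewrite mulr0.
    rewrite -cF (_ : F = 0) ?mcoeff0 //; apply: nf => //; apply/(vord_condition_mx z hF).
    have -> : form_coefs F = col j B.
      by apply/colP => k; rewrite mxE cF [RHS]mxE.
    by rewrite colE mulmxA mulmx_coker mul0mx.
  exists (fullrankfun fullA).
  by have := fullrowsub_unit fullA; rewrite unitmxE unitfE.
have uA : rowsub f (condition_mx z) \in unitmx by rewrite unitmxE unitfE.
have /(vord_condition_mx _ hF) e := ordF.
have {}e : rowsub f (condition_mx z) *m form_coefs F = 0.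
  by rewrite mul_rowsub_mx e; apply/matrixP => i j; rewrite !mxE.
have u0 : form_coefs F = 0.
  by have := mulKmx uA (form_coefs F); rewrite e mulmx0 => <-.
rewrite (homog_sum_monomials hF) big1 // => m _.
have := congr1 (fun c : 'cV[K]_p => c (enum_rank m) 0) u0.
by rewrite !mxE enum_rankK => ->; rewrite scale0r.
Qed.

End Field.

End ConditionMatrix.

Lemma mxvec_index_eq m n (i i' : 'I_m) (j j' : 'I_n) :
  (mxvec_index i j == mxvec_index i' j') = (i == i') && (j == j').
Proof.
by rewrite /mxvec_index (inj_eq (@cast_ord_inj _ _ _)) (inj_eq enum_rank_inj).
Qed.

(** * Multihomogeneity of the minors *)

Section Multihomogeneous.

Variables (k : fieldType) (N n : nat).
Local Notation R := {mpoly k[n * N.+1]}.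
Implicit Types (F G : R) (D E : 'I_n -> nat).

Definition multideg D F := forall m, m \in msupp F ->
  forall i : 'I_n, (\sum_(j < N.+1) m (mxvec_index i j))%N = D i.

Lemma multideg_multihomog D F : multideg D F -> multihomog F.
Proof. by exists D. Qed.

Lemma eq_multideg D E F : D =1 E -> multideg D F -> multideg E F.
Proof. by move=> e h m mF i; rewrite -e h. Qed.

Lemma multideg0 D : multideg D 0.
Proof. by move=> m; rewrite msupp0. Qed.

Lemma multidegC c : multideg (fun=> 0%N) c%:MP.
Proof.
move=> m; rewrite msuppC; case: ifP => // _; rewrite inE => /eqP -> i.
by rewrite big1 // => j _; rewrite mnm0E.
Qed.

Lemma multidegD D F G : multideg D F -> multideg D G -> multideg D (F + G).
Proof.
by move=> hF hG m /msuppD_le; rewrite mem_cat => /orP [/hF|/hG].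
Qed.

Lemma multidegM D E F G : multideg D F -> multideg E G ->
  multideg (fun i => D i + E i)%N (F * G).
Proof.
move=> hF hG m /msuppM_le /allpairsP [[m1 m2] /= [/hF h1 /hG h2 ->]] i.
by rewrite -h1 -h2 -big_split; apply: eq_bigr => j _; rewrite mnmDE.
Qed.

Lemma multideg_prod (J : Type) (s : seq J) (P : pred J) (D : J -> 'I_n -> nat) (F : J -> R) :
  (forall j, P j -> multideg (D j) (F j)) ->
  multideg (fun i => \sum_(j <- s | P j) D j i)%N (\prod_(j <- s | P j) F j).
Proof.
move=> hF; elim: s => [|j s IHs].
  rewrite big_nil -mpolyC1; apply: eq_multideg (@multidegC 1) => i.
  by rewrite big_nil.
rewrite big_cons; case: ifP => Pj.
  by apply: eq_multideg (multidegM (hF j Pj) IHs) => i; rewrite big_cons Pj.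
by apply: eq_multideg IHs => i; rewrite big_cons Pj.
Qed.

Lemma multideg_exp D F e : multideg D F -> multideg (fun i => e * D i)%N (F ^+ e).
Proof.
move=> hF; elim: e => [|e IHe]; first by rewrite expr0 -mpolyC1; apply: multidegC.
by rewrite exprS; apply: eq_multideg (multidegM hF IHe) => i; rewrite mulSn.
Qed.

Lemma multidegX i j :
  multideg (fun i' => i' == i : nat) ('X_(mxvec_index i j) : R).
Proof.
move=> m; rewrite msuppX inE => /eqP -> i'.
under eq_bigr => j' _ do rewrite mnm1E mxvec_index_eq.
rewrite eq_sym; case: eqP => _; last by rewrite big1.
by rewrite (bigD1 j) //= eqxx big1 // => j'; rewrite eq_sym => /negPf ->.
Qed.

Lemma prod_mxvec_index (S : comNzRingType) (h : 'I_(n * N.+1) -> S) :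
  \prod_l h l = \prod_i \prod_j h (mxvec_index i j).
Proof. by rewrite pair_bigA (reindex _ (curry_mxvec_bij _ _)); apply: eq_bigr => -[i j]. Qed.

Lemma multideg_scale D F (c : 'I_n -> k) (z : 'M[k]_(n, N.+1)) : multideg D F ->
  F.@[mxvec (\matrix_(i, j) (c i * z i j)) 0] = (\prod_i c i ^+ D i) * F.@[mxvec z 0].
Proof.
move=> hF; rewrite !mevalE mulr_sumr big_seq [RHS]big_seq; apply: eq_bigr => m /hF hm.
rewrite mulrCA; congr (_ * _); rewrite !prod_mxvec_index -big_split; apply: eq_bigr => i _ /=.
rewrite -hm -prodrXr -big_split; apply: eq_bigr => j _ /=.
by rewrite !mxvecE mxE exprMn.
Qed.

Definition generic_mx : 'M[R]_(n, N.+1) := \matrix_(i, j) 'X_(mxvec_index i j).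

Lemma map_generic_mx (z : 'M[k]_(n, N.+1)) : map_mx (meval (mxvec z 0)) generic_mx = z.
Proof. by apply/matrixP => i j; rewrite !mxE mevalXU mxvecE. Qed.

Section Minors.

Variables d r : nat.

(** Each row of the condition matrix involves one point only and has degree [d - mdeg c.2] in it,
    whatever the monomial; this makes the minors multihomogeneous. *)
Lemma multideg_condition_entry (c : 'I_n * 'X_{1..N.+1 < r})
    (m : {m : 'X_{1..N.+1 < d.+1} | mdeg m == d}) :
  multideg (fun i => (i == c.1) * (d - mdeg c.2))%N (condition_entry generic_mx c m).
Proof.
rewrite /condition_entry.
(* If some exponent of [c.2] exceeds that of [m], truncated subtraction spoils the degree, but a
   falling factorial is 0 and so is the entry. *)
have [/forallP cm'|] := boolP [forall j, (c.2 j <= val m j)%N]; last first.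
  rewrite negb_forall => /existsP [j]; rewrite -ltnNge => mj.
  by rewrite (bigD1 j) //= ffact_small // mul0n mul0r; apply: multideg0.
have /mnm_lepP cm : forall j, (c.2 j <= val m j)%N := cm'.
rewrite -mpolyC_nat.
rewrite (eq_bigr (fun j => 'X_(mxvec_index c.1 j) ^+ (val m j - c.2 j))) => [|j _]; last first.
  by rewrite mxE.
have h := multideg_prod (s := index_enum 'I_N.+1) (P := xpredT)
  (fun j _ => @multideg_exp _ _ (val m j - c.2 j) (@multidegX c.1 j)).
apply: eq_multideg (multidegM (@multidegC _) h).
move=> i /=; rewrite add0n -big_distrl /= mulnC; congr (_ * _)%N.
have dm : mdeg (val m) = d by apply/eqP/(valP m).
rewrite -[RHS](congr1 (subn^~ (mdeg c.2)) dm) -{2}(submK cm) mdegD addnK mdegE.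
by apply: eq_bigr => j _; rewrite mnmBE.
Qed.

Lemma multideg_minor f : exists D,
  multideg D (condition_minor (d := d) (r := r) generic_mx f).
Proof.
pose cond j := (enum_val (f j) : 'I_n * 'X_{1..N.+1 < r}).
exists (fun i => \sum_j (i == (cond j).1) * (d - mdeg (cond j).2))%N.
rewrite /condition_minor /determinant.
apply: (big_ind (multideg _)) => [||s _]; [exact: multideg0|exact: multidegD|].
rewrite -(rmorph_sign (@mpolyC _ k)).
rewrite (eq_bigr (fun j => condition_entry generic_mx (cond j) (enum_val (s j))))
  => [|j _]; last by rewrite !mxE.
have h := multideg_prod (s := index_enum 'I_#|{: {m : 'X_{1..N.+1 < d.+1} | mdeg m == d}}|)
  (P := xpredT) (fun j _ => @multideg_condition_entry (cond j) (enum_val (s j))).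
apply: eq_multideg (multidegM (@multidegC _) h).
by move=> i; rewrite add0n.
Qed.

(* Nonvanishing of one of these polynomials expresses that no form of degree
   [d] vanishes to order [r] at the given points, none of which lies on the
   hyperplane [X_0 = 0]. *)
Definition condition_poly f : R :=
  (\prod_i generic_mx i 0) * condition_minor (d := d) (r := r) generic_mx f.

Lemma multideg_condition_poly f : exists D, multideg D (condition_poly f).
Proof.
have [D hD] := multideg_minor f.
have h := multideg_prod (s := index_enum 'I_n) (P := xpredT) (fun i _ => @multidegX i 0).
exists (fun i => \sum_(i0 < n) (i == i0) + D i)%N.
rewrite /condition_poly; apply: multidegM hD.
rewrite (eq_bigr (fun i => 'X_(mxvec_index i 0))) => [|i _]; last by rewrite mxE.
exact: h.
Qed.

(** [phi] is later an evaluation at given points, or the embedding into the field of fractions,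
    which yields the generic points. *)
Lemma condition_polyP (K : fieldType) (phi : {rmorphism R -> K}) :
  let z := map_mx phi generic_mx in
  (exists f, phi (condition_poly f) != 0) <->
  (forall i, z i 0 != 0) /\ no_form d r (fun i j => z i j).
Proof.
move=> z; have e f : phi (condition_poly f) = (\prod_i z i 0) * condition_minor z f.
  rewrite /condition_poly rmorphM condition_minor_map rmorph_prod; congr (_ * _).
  by apply: eq_bigr => i _; rewrite [RHS]mxE.
split=> [[f]|[z0 /no_form_minor [f f0]]].
  rewrite e mulf_eq0 negb_or => /andP [/prodf_neq0 z0 f0].
  by split=> [i|]; [apply: z0|apply/no_form_minor; exists f].
by exists f; rewrite e mulf_neq0 //; apply/prodf_neq0.
Qed.

End Minors.

End Multihomogeneous.

(** * The ideal of the points and its powers *)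

Section IdealOps.

Variable A : comNzRingType.
Implicit Types (I J : A -> Prop).

Lemma ideal_gen_ideal (S : A -> Prop) : is_ideal (ideal_gen S).
Proof.
split=> [|f g [s [hs ->]] [t [ht ->]]|a f [s [hs ->]]].
- by exists [::]; rewrite big_nil.
- exists (s ++ t); rewrite big_cat; split=> // c; rewrite mem_cat.
  by case/orP; [apply: hs|apply: ht].
- exists [seq (a * c.1, c.2) | c <- s]; split=> [_ /mapP [c /hs cS ->] //|].
  by rewrite big_map mulr_sumr; apply: eq_bigr => c _; rewrite mulrA.
Qed.

Lemma mem_ideal_gen (S : A -> Prop) f : S f -> ideal_gen S f.
Proof.
move=> Sf; exists [:: (1, f)]; rewrite big_seq1 mul1r; split=> // c.
by rewrite inE => /eqP ->.
Qed.

Lemma ideal_gen_min (S : A -> Prop) I :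
  is_ideal I -> ideal_sub S I -> ideal_sub (ideal_gen S) I.
Proof.
case=> I0 ID IM SI f [s [hs ->]]; rewrite big_seq.
by apply: (big_ind I) => // c /hs/SI; apply: IM.
Qed.

Lemma ideal_sum I (T : Type) (s : seq T) (P : pred T) F : is_ideal I ->
  (forall i, P i -> I (F i)) -> I (\sum_(i <- s | P i) F i).
Proof. by case=> I0 ID _ hF; apply: (big_ind I). Qed.

Lemma idealN I f : is_ideal I -> I f -> I (- f).
Proof. by case=> _ _ IM If; rewrite -mulN1r; apply: IM. Qed.

Lemma idealB I f g : is_ideal I -> I f -> I g -> I (f - g).
Proof. by move=> hI If Ig; have [_ ID _] := hI; apply: ID => //; apply: idealN. Qed.

Lemma ideal_mulr I f a : is_ideal I -> I f -> I (f * a).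
Proof. by case=> _ _ IM If; rewrite mulrC; apply: IM. Qed.

Lemma ideal_mull I f a : is_ideal I -> I f -> I (a * f).
Proof. by case=> _ _ IM; apply: IM. Qed.

Lemma mem_ideal_mul I J f g : I f -> J g -> ideal_mul I J (f * g).
Proof. by move=> If Jg; apply: mem_ideal_gen; exists f, g. Qed.

Lemma ideal_pow_ideal I m : is_ideal (ideal_pow I m).
Proof. by case: m => [|m]; [split|apply: ideal_gen_ideal]. Qed.

Lemma ideal_pow_prod I m (F : 'I_m -> A) :
  (forall i, I (F i)) -> ideal_pow I m (\prod_(i < m) F i).
Proof.
elim: m F => [//|m IHm] F IF; rewrite big_ord_recl.
by apply: mem_ideal_mul => //; apply: IHm.
Qed.

Lemma ideal_pow_exp I m f : I f -> ideal_pow I m (f ^+ m).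
Proof.
by move=> If; rewrite -[m in f ^+ m]card_ord -prodr_const; apply: ideal_pow_prod.
Qed.

Lemma ideal_pow_leq I m r : (m <= r)%N -> ideal_sub (ideal_pow I r) (ideal_pow I m).
Proof.
move=> le_mr; rewrite -(subnK le_mr); elim: (r - m)%N => [//|k IHk] f.
apply: ideal_gen_min; first exact: ideal_pow_ideal.
by move=> _ [g [h [_ /IHk hI ->]]]; exact: ideal_mull (ideal_pow_ideal _ _) hI.
Qed.

Lemma radical_add (Q : A -> Prop) f g i j :
  is_ideal Q -> Q (f ^+ i) -> Q (g ^+ j) -> Q ((f + g) ^+ (i + j)).
Proof.
move=> hQ Qf Qg; rewrite exprDn; apply: ideal_sum => // l _.
rewrite -mulr_natr; apply: ideal_mulr => //.
have [lej|ltj] := leqP j l.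
  by apply: ideal_mull => //; rewrite -(subnK lej) exprD; apply: ideal_mull.
apply: ideal_mulr => //.
have -> : (i + j - l = (j - l) + i)%N by lia.
by rewrite exprD; apply: ideal_mull.
Qed.

Lemma radical_sum (Q : A -> Prop) (T : Type) (s : seq T) (P : pred T) F : is_ideal Q ->
  (forall i, P i -> exists e, Q (F i ^+ e)) ->
  exists e, Q ((\sum_(i <- s | P i) F i) ^+ e).
Proof.
move=> hQ hF; apply: (big_ind (fun f => exists e, Q (f ^+ e))) => //.
  by exists 1%N; rewrite expr1; case: hQ.
by move=> f g [i Qi] [j Qj]; exists (i + j)%N; apply: radical_add.
Qed.

End IdealOps.

(** * Homogeneous parts and lines through the origin *)

Notation hpart := (pihomog mdeg).

Section HomogeneousParts.

Variables (K : fieldType) (n : nat).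
Implicit Types (f F : {mpoly K[n]}) (v : 'I_n -> K).

Lemma mcoeff_hpart d f m : (hpart d f)@_m = if mdeg m == d then f@_m else 0.
Proof.
elim/mpolyind: f => [|c m' f _ _ IHf]; first by rewrite pihomog0 !mcoeff0 if_same.
rewrite raddfD /= linearZ /= pihomogX !mcoeffD IHf !mcoeffZ.
have [->|mm'] := eqVneq m' m.
  by case: ifP => _; rewrite ?mcoeff0 ?mulr0 ?addr0.
by case: ifP => _; rewrite ?mcoeff0 mcoeffX (negPf mm') mulr0 !add0r.
Qed.

Lemma sum_hpart f : f = \sum_(d < msize f) hpart d f.
Proof.
apply/mpolyP => m; rewrite (raddf_sum (mcoeff m)) /=.
under eq_bigr => d _ do rewrite mcoeff_hpart.
case: (boolP (m \in msupp f)) => [mf|/memN_msupp_eq0 ->]; last first.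
  by rewrite big1 // => d _; rewrite if_same.
rewrite (bigD1 (Ordinal (msize_mdeg_lt mf))) //= eqxx big1 ?addr0 // => d.
by rewrite -val_eqE /= eq_sym => /negPf ->.
Qed.

Lemma hpart_homog d f : hpart d f \is d.-homog.
Proof. exact: pihomogP. Qed.

Lemma hpart_id d F : F \is d.-homog -> hpart d F = F.
Proof. exact: pihomog_dE. Qed.

Lemma hpart_mulr d e f F : F \is e.-homog -> hpart (d + e) (f * F) = hpart d f * F.
Proof.
move=> hF; rewrite {1}(sum_hpart f) mulr_suml raddf_sum /=.
have [ltd|led] := ltnP d (msize f).
  rewrite (bigD1 (Ordinal ltd)) //= big1 ?addr0.
    by rewrite pihomog_dE // dhomogM // hpart_homog.
  move=> i id; have hi := dhomogM (hpart_homog i f) hF.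
  by rewrite (pihomog_ne0 _ hi) // eqn_add2r.
rewrite big1 => [|i _].
  suff -> : hpart d f = 0 by rewrite mul0r.
  apply/mpolyP => m; rewrite mcoeff_hpart mcoeff0; case: ifP => // /eqP dm.
  by apply/eqP; rewrite mcoeff_eq0; apply: msize_mdeg_ge; rewrite dm.
have hi := dhomogM (hpart_homog i f) hF.
by rewrite (pihomog_ne0 _ hi) // eqn_add2r; have := ltn_ord i; lia.
Qed.

Lemma mderiv_hpart d f i : (hpart d.+1 f)^`M(i) = hpart d f^`M(i).
Proof.
apply/mpolyP => m; rewrite mcoeff_mderiv !mcoeff_hpart mcoeff_mderiv mdegD mdeg1.
by rewrite addn1 eqSS; case: ifP => // _; rewrite mul0rn.
Qed.

Lemma mderiv_hpart0 f i : (hpart 0 f)^`M(i) = 0.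
Proof.
apply/mpolyP => m; rewrite mcoeff_mderiv !mcoeff_hpart mdegD mdeg1 addn1.
by rewrite mcoeff0 mul0rn.
Qed.

Lemma euler_homog d F : F \is d.-homog -> \sum_i 'X_i * F^`M(i) = d%:R *: F.
Proof.
move=> /dhomogP hF; rewrite (mpolyE F) scaler_sumr.
under eq_bigr => i _ do rewrite raddf_sum mulr_sumr.
rewrite exchange_big big_seq [RHS]big_seq; apply: eq_bigr => m mF.
have <- := hF _ mF.
under eq_bigr => i _.
  rewrite /= mderivZ mderivX -scalerAr -scalerAr scalerA.
  have -> : (F@_m * (m i)%:R) *: ('X_i * 'X_[m - U_(i)]) = (F@_m * (m i)%:R) *: 'X_[m].
    have [->|mi] := eqVneq (m i) 0%N; first by rewrite mulr0 !scale0r.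
    by rewrite -mpolyXD addmC submK // lep1mP.
  over.
by rewrite -scaler_suml -mulr_sumr -natr_sum /= mdegE scalerA mulrC.
Qed.

(* [f |-> f (v X)], whose coefficients are the values at [v] of the homogeneous
   parts of [f]. *)
Definition ray v : {mpoly K[n]} -> {poly K} := line (fun=> 0) v.

HB.instance Definition _ v := GRing.RMorphism.on (ray v).

Lemma ray_homog d F v : F \is d.-homog -> ray v F = F.@[v] *: 'X^d.
Proof.
move=> /dhomogP hF; rewrite /ray /line /mmap mevalE scaler_suml big_seq [RHS]big_seq.
apply: eq_bigr => m /hF <-; rewrite mul_polyC -scalerA; congr (_ *: _).
rewrite /mmap1 /= mdegE; under eq_bigr => i _ do rewrite polyC0 add0r exprZn.
by rewrite scaler_prod prodrXr.
Qed.

Lemma coef_ray d f v : (ray v f)`_d = (hpart d f).@[v].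
Proof.
rewrite {1}(sum_hpart f) rmorph_sum coef_sum /=.
under eq_bigr => i _ do rewrite (ray_homog _ (hpart_homog i f)) coefZ coefXn.
have [ltd|led] := ltnP d (msize f).
  rewrite (bigD1 (Ordinal ltd)) //= eqxx mulr1 big1 ?addr0 // => i.
  by rewrite -val_eqE /= eq_sym => /negPf ->; rewrite mulr0.
rewrite big1 => [|i _].
  suff -> : hpart d f = 0 by rewrite meval0.
  apply/mpolyP => m; rewrite mcoeff_hpart mcoeff0; case: ifP => // /eqP dm.
  by apply/eqP; rewrite mcoeff_eq0; apply: msize_mdeg_ge; rewrite dm.
by rewrite (gtn_eqF (leq_trans (ltn_ord i) led)) mulr0.
Qed.

Lemma ray_eq0 f v : ray v f = 0 <-> forall d, (hpart d f).@[v] = 0.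
Proof.
split=> [r0 d|h]; first by rewrite -coef_ray r0 coef0.
by apply/polyP => d; rewrite coef_ray h coef0.
Qed.

Lemma ray_horner f v c : (ray v f).[c] = f.@[fun i => c * v i].
Proof. by rewrite /ray line_horner; apply: meval_eq => i; rewrite add0r. Qed.

(* If [f] vanishes to order [r] at almost all points of a line through the
   origin, then so does each of its homogeneous parts. *)
Lemma vord_hpart (K0 : [pchar K] =i pred0) r v f (q : {poly K}) : q != 0 ->
  (forall c, q.[c] != 0 -> vord r (fun i => c * v i) f) ->
  forall d, vord r v (hpart d f).
Proof.
move=> q0; elim: r f => [//|r IHr] f hf d.
have r0 : ray v f = 0.
  have : q * ray v f = 0.
    apply: poly_nat_roots K0 _ _ => k; rewrite hornerM ray_horner.
    by have [->|/hf [-> _]] := eqVneq q.[k%:R] 0; rewrite ?mul0r ?mulr0.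
  by move/eqP; rewrite mulf_eq0 (negPf q0) => /eqP.
split=> [|i]; first by have /ray_eq0 := r0; apply.
have Df := IHr f^`M(i) (fun c qc => proj2 (hf c qc) i).
by case: d => [|d]; rewrite ?mderiv_hpart0 ?mderiv_hpart; [apply: vord0|apply: Df].
Qed.

End HomogeneousParts.

(** Evaluation of forms of degree [b] at the points is injective by [no_form]. There are as many
    points as monomials of degree [b], so it is onto, and [S i] is a preimage of a unit vector. *)
Lemma exists_separators (K : fieldType) (N b : nat)
    (v : 'I_('C(b + N, N)) -> 'I_N.+1 -> K) : no_form b 1 v ->
  exists S : 'I_('C(b + N, N)) -> {mpoly K[N.+1]},
    (forall i, S i \is b.-homog) /\ forall i j, (S i).@[v j] = (i == j)%:R.
Proof.
move=> nf; pose ev (F : dhomog N.+1 K b) : 'rV[K]_('C(b + N, N)) :=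
  \row_j (F : {mpoly K[N.+1]}).@[v j].
have ev_lin : linear ev.
  by move=> c F G; apply/rowP => j; rewrite !mxE mevalD mevalZ.
pose evL := GRing.isLinear.Build _ _ _ _ ev ev_lin.
pose f : 'Hom(dhomog N.+1 K b, 'rV[K]_('C(b + N, N))) :=
  linfun (HB.pack_for {linear dhomog N.+1 K b -> 'rV[K]_('C(b + N, N))} ev evL).
have fE F : f F = ev F by rewrite lfunE.
have kf : (fullv :&: lker f = 0)%VS.
  apply/eqP; rewrite -subv0; apply/subvP => F; rewrite memv_cap memvf memv_ker fE memv0 /=.
  move=> /eqP/rowP e; apply/eqP/val_inj; apply: nf; first exact: dhomog_is_dhomog.
  by move=> i; split=> //; have := e i; rewrite !mxE.
have onto : limg f = fullv.
  apply/eqP; rewrite eqEdim subvf (limg_dim_eq kf) !dimvf.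
  by rewrite /dim /= mul1n -(bin_sub (leq_addr N b)) addKn.
have inv i : exists F : dhomog N.+1 K b, ev F = delta_mx 0 i.
  have : delta_mx 0 i \in limg f by rewrite onto memvf.
  by case/memv_imgP => F _ ->; exists F; rewrite fE.
have /fin_all_exists [S hS] := inv.
exists (fun i => S i); split=> [i|i j]; first exact: dhomog_is_dhomog.
by have := congr1 (fun r : 'rV_ _ => r 0 j) (hS i); rewrite !mxE eqxx eq_sym.
Qed.

(** * The ideal of points that have separators and avoid [x_0 = 0] *)

Section PointIdeal.

Variables (K : fieldType) (K0 : [pchar K] =i pred0) (N b n : nat).
Variables (v : 'I_n -> 'I_N.+1 -> K) (v0 : forall i, v i 0 != 0).
Variables (nf : no_form b 1 v).
Local Notation A := {mpoly K[N.+1]}.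
Variables (S : 'I_n -> A) (S_homog : forall i, S i \is b.-homog).
Variables (S_dual : forall i j, (S i).@[v j] = (i == j)%:R).
Variables (I : A -> Prop) (I_ray : forall f, I f <-> forall i, ray (v i) f = 0).
Implicit Types (f g F : A).

Local Notation l := ('X_ord0 : A).

Lemma meval_separators (c : 'I_n -> K) j : (\sum_i c i *: S i).@[v j] = c j.
Proof.
rewrite (bigD1 j) // mevalD mevalZ S_dual eqxx mulr1 raddf_sum big1 ?addr0 // => i ij.
by rewrite -[LHS]/(_.@[v j]) mevalZ S_dual (negPf ij) mulr0.
Qed.

Lemma I_ideal : is_ideal I.
Proof.
split=> [|f g /I_ray hf /I_ray hg|a f /I_ray hf]; apply/I_ray => i.
- exact: rmorph0.
- by rewrite rmorphD /= hf hg addr0.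
- by rewrite rmorphM /= hf mulr0.
Qed.

Lemma I_homog d F : F \is d.-homog -> I F <-> forall i, F.@[v i] = 0.
Proof.
move=> hF; rewrite I_ray; split=> h i; have := h i; rewrite (ray_homog _ hF).
  by move/(congr1 (fun p : {poly K} => p`_d)); rewrite coefZ coefXn eqxx mulr1 coef0.
by move=> ->; rewrite scale0r.
Qed.

Lemma I_hpart f d : I f -> I (hpart d f).
Proof.
move=> /I_ray hf; apply/(I_homog (hpart_homog d f)) => i.
by have /ray_eq0 := hf i; apply.
Qed.

Lemma I_cancel_l f : I (l * f) -> I f.
Proof.
move=> /I_ray h; apply/I_ray => i; have /eqP := h i; rewrite rmorphM /= mulf_eq0.
have -> : (ray (v i) l == 0) = false; last by move/eqP.
apply/negbTE; rewrite /ray lineX add0r -size_poly_eq0 size_scale ?v0 //.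
by rewrite size_polyX.
Qed.

Lemma l_exp_homog e : l ^+ e \is e.-homog.
Proof. by rewrite -[e in e.-homog]mul1n dhomogMn // dhomogX /= mdeg1. Qed.

Lemma I_low d F : (d <= b)%N -> F \is d.-homog -> I F -> F = 0.
Proof.
move=> db hF IF; have lF : l ^+ (b - d) * F \is b.-homog.
  by rewrite -{2}(subnK db) dhomogM // l_exp_homog.
have : l ^+ (b - d) * F = 0.
  apply: nf => // i; split=> //; rewrite mevalM.
  by have /(I_homog hF) -> := IF; rewrite mulr0.
move/eqP; rewrite mulf_eq0 expf_eq0 => /orP [/andP [_]|/eqP //].
by rewrite -msize_poly_eq0 msizeX.
Qed.

(* The kernel of [ray (v i)] is the ideal of the i-th point; it is the
   annihilator of [S i] modulo [I], hence an associated prime. *)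
Lemma symbolic_pow_vord r f : symbolic_pow I r f ->
  forall d i, vord r (v i) (hpart d f).
Proof.
move=> hf d i; pose p g := ray (v i) g = 0.
have p_prime : is_prime p.
  split=> [||g h /eqP]; last by rewrite rmorphM mulf_eq0 => /orP [] /eqP; [left|right].
  - split=> [|g h|a g]; rewrite /p ?rmorph0 ?rmorphD ?rmorphM //=.
      by move=> -> ->; rewrite addr0.
    by move=> ->; rewrite mulr0.
  - by rewrite /p rmorph1; apply/eqP/oner_neq0.
have p_assoc : is_assoc_prime I p.
  split=> //; exists (S i) => g; split=> [pg|/I_ray /(_ i) /eqP].
    apply/I_ray => j; rewrite rmorphM /= (ray_homog _ (S_homog i)) S_dual.
    have [<-|_] := eqVneq i j; last by rewrite scale0r mulr0.
    by rewrite pg mul0r.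
  rewrite rmorphM /= (ray_homog _ (S_homog i)) S_dual eqxx scale1r mulf_eq0.
  by rewrite expf_eq0 polyX_eq0 andbF orbF => /eqP.
have [s [/eqP ps Isf]] := hf p p_assoc.
apply: (vord_hpart K0 ps) => c; rewrite ray_horner => sc.
apply: vord_cancel sc _; apply: vord_ideal_pow Isf => g /I_ray /(_ i).
by move/(congr1 (horner^~ c)); rewrite ray_horner horner0.
Qed.

(** Differentiation in the direction of the point itself keeps the order: by Euler's relation its
    value there is [d] times that of [F], and it commutes with partial derivatives. *)
Lemma vord_dirderiv m d F i : F \is d.-homog -> vord m (v i) F ->
  vord m (v i) (\sum_j v i j *: F^`M(j)).
Proof.
elim: m d F => [//|m IHm] d F hF [F0 DF].
have := congr1 (meval (v i)) (euler_homog hF).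
rewrite mevalZ F0 mulr0 raddf_sum /= => e; split=> [|k].
  by rewrite raddf_sum /= -[RHS]e; apply: eq_bigr => j _; rewrite mevalZ mevalM mevalXU.
rewrite raddf_sum /=.
under eq_bigr => j _ do rewrite mderivZ mderiv_comm.
exact: IHm (dhomog_mderiv k hF) (DF k).
Qed.

(* Euler's relation writes [F] in terms of the products of its partial
   derivatives with the linear forms vanishing at the i-th point; [S i] maps
   those linear forms into [I]. *)
Lemma separator_pow_mul m d F i : F \is d.-homog -> vord m (v i) F ->
  ideal_pow I m (S i ^+ m * F).
Proof.
elim: m d F => [//|m IHm] d F.
have hI := ideal_pow_ideal I m.+1.
elim: d F => [|d IHd] F hF ordF.
  have [F0 _] := ordF; suff -> : F = 0 by rewrite mulr0; case: hI.
  have sF := dhomog_msize_leq hF; move: F0; rewrite (msize1_polyC sF) mevalC => ->.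
  by rewrite mpolyC0.
have e := euler_homog hF.
pose y j : A := 'X_j - (v i j / v i 0) *: l.
have Sy j : I (S i * y j).
  have hSy : S i * y j \is (b + 1).-homog.
    rewrite dhomogM //; apply: rpredB; first by rewrite dhomogX /= mdeg1.
    by rewrite rpredZ // dhomogX /= mdeg1.
  apply/(I_homog hSy) => k; rewrite mevalM S_dual mevalB mevalZ !mevalXU.
  have [<-|_] := eqVneq i k; last by rewrite mul0r.
  by rewrite divfK ?v0 // subrr mulr0.
have : ideal_pow I m.+1 (d.+1%:R%:MP * (S i ^+ m.+1 * F)).
  rewrite mulrCA mul_mpolyC -e.
  (* In the terms with [y j] the order drops together with [m]; in the remaining term, a multiple of
     the directional derivative, only the degree drops. *)
  have -> : \sum_j 'X_j * F^`M(j) =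
      \sum_j y j * F^`M(j) + (v i 0)^-1 *: l * (\sum_j v i j *: F^`M(j)).
    rewrite mulr_sumr -big_split; apply: eq_bigr => j _ /=.
    rewrite /y mulrBl -[X in _ = _ - X + _]scalerAl -scalerAl -scalerAr scalerA.
    by rewrite mulrC [v i j / _]mulrC addrNK.
  have [_ ID IM] := hI.
  rewrite mulrDr; apply: ID.
    rewrite mulr_sumr; apply: ideal_sum => // j _.
    rewrite exprS mulrACA; apply: mem_ideal_mul (Sy j) _.
    apply: IHm (dhomog_mderiv j hF) _; exact: (proj2 ordF).
  rewrite mulrCA; apply: IM; apply: IHd.
    by apply: rpred_sum => j _; apply: rpredZ; apply: dhomog_mderiv hF.
  exact: vord_dirderiv hF ordF.
move=> h; have [_ _ /(_ (d.+1%:R^-1)%:MP _ h)] := hI.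
by rewrite !mulrA -mpolyCM mulVf ?natrS_neq0 // mpolyC1 mul1r.
Qed.

Lemma ideal_colon (J : A -> Prop) F : is_ideal J -> is_ideal (fun g => J (g * F)).
Proof.
case=> J0 JD JM; split=> [|f g|a f]; first by rewrite mul0r.
  by rewrite mulrDl; apply: JD.
by rewrite -mulrA; apply: JM.
Qed.

(** The colon ideal [Q] of [I^m] by [F] contains powers of the separators, hence of [s]. As [s]
    agrees with [x_0^b] at the points, [x_0^b] is the sum of [s] and a member of [I], and [Q]
    contains a power of it. *)
Lemma l_pow_mul m d F : F \is d.-homog -> (forall i, vord m (v i) F) ->
  exists e, ideal_pow I m (l ^+ e * F).
Proof.
move=> hF ordF; pose Q g := ideal_pow I m (g * F).
have hQ : is_ideal Q := ideal_colon F (ideal_pow_ideal I m).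
pose s := \sum_i v i 0 ^+ b *: S i.
have [e1 Qs] : exists e, Q (s ^+ e).
  apply: radical_sum => // i _; exists m; rewrite -mul_mpolyC exprMn.
  apply: (ideal_mull _ hQ); exact: separator_pow_mul hF (ordF i).
have hls : l ^+ b - s \is b.-homog.
  apply: rpredB; first exact: l_exp_homog.
  apply: rpred_sum => i _; apply: rpredZ; exact: S_homog.
have Ih : I (l ^+ b - s).
  by apply/(I_homog hls) => j; rewrite mevalB meval_separators rmorphXn /= mevalXU subrr.
have Qh : Q ((l ^+ b - s) ^+ m).
  by apply: ideal_mulr; [apply: ideal_pow_ideal|apply: ideal_pow_exp].
exists (b * (m + e1))%N; rewrite exprM.
by have := radical_add hQ Qh Qs; rewrite subrK.
Qed.

Lemma mulX_homog j d F : F \is d.-homog -> 'X_j * F \is d.+1.-homog.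
Proof.
have hX : ('X_j : A) \is 1.-homog by rewrite dhomogX /= mdeg1.
by move/(dhomogM hX).
Qed.

(* The form of [I] that agrees with [F] modulo [l], for [F] of degree [b.+1]. *)
Definition vanishing_lift F := F - l * \sum_i (F.@[v i] / v i 0) *: S i.

Lemma vanishing_lift_homog F :
  F \is b.+1.-homog -> vanishing_lift F \is b.+1.-homog.
Proof.
move=> hF; apply: rpredB hF (mulX_homog _ _).
by apply: rpred_sum => i _; apply: rpredZ; apply: S_homog.
Qed.

Lemma vanishing_lift_I F : F \is b.+1.-homog -> I (vanishing_lift F).
Proof.
move=> hF; apply/(I_homog (vanishing_lift_homog hF)) => j.
by rewrite mevalB mevalM mevalXU meval_separators mulrC divfK ?v0 // subrr.
Qed.

(** Both products are [x_i x_j F] modulo [x_0]. Their difference lies in [I], and [x_0], nonzero at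
    all the points, cancels in [I]. *)
Lemma vanishing_lift_relation i j F : F \is b.-homog ->
  exists2 H, I H &
    'X_i * vanishing_lift ('X_j * F) - 'X_j * vanishing_lift ('X_i * F) = l * H.
Proof.
move=> hF; have hXF k : 'X_k * F \is b.+1.-homog.
  exact: mulX_homog.
pose h G := \sum_i (G.@[v i] / v i 0) *: S i.
have e : 'X_i * vanishing_lift ('X_j * F) - 'X_j * vanishing_lift ('X_i * F)
    = l * ('X_j * h ('X_i * F) - 'X_i * h ('X_j * F)).
  rewrite /vanishing_lift -!/(h _) !mulrBr opprB mulrCA addrACA addrC.
  rewrite -addrA [X in _ + X]addrC -addrA; ring.
exists ('X_j * h ('X_i * F) - 'X_i * h ('X_j * F)); last exact: e.
apply: I_cancel_l; rewrite -e; apply: (idealB I_ideal).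
  by apply: (ideal_mull _ I_ideal); apply: vanishing_lift_I.
by apply: (ideal_mull _ I_ideal); apply: vanishing_lift_I.
Qed.

Definition setx0 : A -> A :=
  mmap (@mpolyC N.+1 K) (fun j => if j == ord0 then 0 else 'X_j).

HB.instance Definition _ := GRing.RMorphism.on setx0.

Lemma setx0C c : setx0 c%:MP = c%:MP.
Proof. exact: mmapC. Qed.

Lemma setx0Z c f : setx0 (c *: f) = c *: setx0 f.
Proof. by rewrite -!mul_mpolyC rmorphM /= setx0C. Qed.

Lemma setx0X j : setx0 'X_j = if j == ord0 then 0 else 'X_j.
Proof. by rewrite /setx0 mmapX mmap1U. Qed.

(** Monomials in [x_1, ..., x_N] are written as words on a finite set of positions, on which
    permutations act. *)
Definition word (J : finType) (w : J -> 'I_N) : A := \prod_j 'X_(lift ord0 (w j)).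

Lemma word_homog (J : finType) (w : J -> 'I_N) : word w \is #|J|.-homog.
Proof.
rewrite /word mprodXE dhomogX /= mdeg_sum.
by under eq_bigr => j _ do rewrite mdeg1; rewrite sum1_card.
Qed.

Lemma setx0_word (J : finType) (w : J -> 'I_N) : setx0 (word w) = word w.
Proof. by rewrite rmorph_prod; apply: eq_bigr => j _ /=; rewrite setx0X. Qed.

Lemma eq_word (J : finType) (w w' : J -> 'I_N) : w =1 w' -> word w = word w'.
Proof. by move=> e; apply: eq_bigr => j _; rewrite e. Qed.

Lemma word_sum (J J' : finType) (w : J + J' -> 'I_N) :
  word w = word (w \o inl) * word (w \o inr).
Proof. by rewrite /word big_sumType. Qed.

Lemma exists_word (J : finType) (m : 'X_{1..N.+1}) : m ord0 = 0%N -> #|J| = mdeg m ->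
  exists w : {ffun J -> 'I_N}, 'X_[m] = word w.
Proof.
move=> m0 cJ; have [s [ss es]] : exists s : seq 'I_N,
    size s = mdeg m /\ 'X_[m] = \prod_(j <- s) 'X_(lift ord0 j) :> A.
  move ed: (mdeg m) => d {cJ}; elim: d m ed m0 => [|d IHd] m em m0.
    exists [::]; split=> //; move/eqP: em; rewrite mdeg_eq0 => /eqP ->.
    by rewrite big_nil mpolyX0.
  have [i mi] : exists i, (U_(i) <= m)%MM by apply: mnm_neq0; rewrite -mdeg_eq0 em.
  have e : m = (U_(i) + (m - U_(i)))%MM by rewrite addmC submK.
  have [j ij] : exists j, i = lift ord0 j.
    case: (unliftP ord0 i) => [j|] ei; first by exists j.
    by move: mi; rewrite lep1mP ei m0.
  have [||s [ss es]] := IHd (m - U_(i))%MM.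
  - by move: em; rewrite {1}e mdegD mdeg1 => -[].
  - by rewrite mnmBE m0.
  by exists (j :: s); rewrite /= ss big_cons -es -ij -mpolyXD -e.
case: s ss es => [|j s] ss es.
  have J0 : #|J| = 0%N by rewrite cJ -ss.
  have w0 (x : J) : 'I_N by have := fintype0 x J0.
  exists (finfun w0); rewrite es big_nil /word big_pred0 // => x.
  by have := fintype0 x J0.
exists [ffun x => nth j (j :: s) (enum_rank x)].
rewrite es /word (big_nth j) big_mkord.
under [RHS]eq_bigr => x _ do rewrite ffunE.
have cs : #|J| = size (j :: s) by rewrite cJ ss.
rewrite (reindex (fun x : J => cast_ord cs (enum_rank x))) //=.
apply: onW_bij; exists (fun y => enum_val (cast_ord (esym cs) y)) => y.
  by rewrite cast_ordK enum_rankK.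
by rewrite enum_valK cast_ordKV.
Qed.

Lemma form_decomp (J : finType) F : F \is #|J|.-homog ->
  exists (a : {ffun J -> 'I_N} -> K) g, F = \sum_w a w *: word w + l * g.
Proof.
move=> /dhomogP hF; rewrite (mpolyE F) big_seq.
apply: (big_ind (fun F : A => exists (a : {ffun J -> 'I_N} -> K) g,
  F = \sum_w a w *: word w + l * g)).
- by exists (fun=> 0), 0; rewrite mulr0 addr0 big1 // => w _; rewrite scale0r.
- move=> _ _ [a [g ->]] [a' [g' ->]]; exists (fun w => a w + a' w), (g + g').
  rewrite mulrDr addrACA -big_split; congr (_ + _).
  by apply: eq_bigr => w _; rewrite scalerDl.
move=> m /hF /= dm; have [m0|m0] := eqVneq (m ord0) 0%N.
  have [//|w ->] := @exists_word J m m0.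
  exists (fun w' => F@_m * (w' == w)%:R), 0; rewrite mulr0 addr0 (bigD1 w) //=.
  by rewrite eqxx mulr1 big1 ?addr0 // => w' /negPf ->; rewrite mulr0 scale0r.
exists (fun=> 0), (F@_m *: 'X_[m - U_(ord0)]); rewrite big1 => [|w _].
  by rewrite add0r -scalerAr -mpolyXD addmC submK // lep1mP.
by rewrite scale0r.
Qed.

(** * Exchange of letters between the factors of a product *)

Section Exchange.

Variables (m r : nat).
Local Notation X := (('I_m * 'I_b.+1) + 'I_r.+1)%type.
Implicit Types (W : X -> 'I_N) (s t : {perm X}).

Definition block W (i : 'I_m) : A := vanishing_lift (word (fun c => W (inl (i, c)))).

(* A lift to [I^m] of the monomial [word W].  The letter [inr ord0] outside the
   blocks is the pivot of all exchanges. *)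
Definition lift_word W : A :=
  (\prod_(i < m) block W i) * word (fun z => W (inr z)).

(** Congruence modulo [x_0 I^m], not merely modulo [x_0]: the quotient by [x_0] has to stay in
    [I^m]. *)
Definition eq_modl f g := exists2 h, ideal_pow I m h & f - g = l * h.

Lemma eq_modl_refl f : eq_modl f f.
Proof. by exists 0; [case: (ideal_pow_ideal I m)|rewrite mulr0 subrr]. Qed.

Lemma eq_modl_trans g f h : eq_modl f g -> eq_modl g h -> eq_modl f h.
Proof.
case=> u uI eu [w wI ew]; exists (u + w); last by rewrite mulrDr -eu -ew addrA subrK.
by case: (ideal_pow_ideal I m) => _ ID _; apply: ID.
Qed.

Lemma block_I W i : I (block W i).
Proof.
by apply: vanishing_lift_I; rewrite -[X in X.-homog]card_ord; apply: word_homog.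
Qed.

(** Only block [i] and the pivot change. By [vanishing_lift_relation] the difference is [x_0] times
    a product in which [H] replaces block [i], so [m] factors from [I] remain. *)
Lemma lift_word_exchange W i c :
  eq_modl (lift_word (W \o tperm (inl (i, c)) (inr ord0))) (lift_word W).
Proof.
set t := tperm _ _; pose W' := W \o t.
pose s := \prod_(c' | c' != c) 'X_(lift ord0 (W (inl (i, c')))) : A.
pose R := \prod_(z : 'I_r) 'X_(lift ord0 (W (inr (lift ord0 z)))) : A.
have sb : s \is b.-homog.
  rewrite /s mprodXE dhomogX /= mdeg_sum.
  under eq_bigr => c' _ do rewrite mdeg1.
  by rewrite sum1_card cardC1 card_ord.
have eW : word (fun c => W (inl (i, c))) = 'X_(lift ord0 (W (inl (i, c)))) * s.
  by rewrite /word (bigD1 c).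
have eW' : word (fun c => W' (inl (i, c))) = 'X_(lift ord0 (W (inr ord0))) * s.
  rewrite /word (bigD1 c) //= /W' /= tpermL; congr (_ * _).
  by apply: eq_bigr => c' cc'; rewrite tpermD // (inj_eq inl_inj) xpair_eqE eqxx /= eq_sym.
have eR : word (fun z => W (inr z)) = 'X_(lift ord0 (W (inr ord0))) * R.
  by rewrite /word big_ord_recl.
have eR' : word (fun z => W' (inr z)) = 'X_(lift ord0 (W (inl (i, c)))) * R.
  rewrite /word big_ord_recl /W' /= tpermR; congr (_ * _).
  by apply: eq_bigr => z _; rewrite tpermD.
have eB i' : i' != i -> block W' i' = block W i'.
  move=> ii'; congr vanishing_lift; apply: eq_word => c'.
  by rewrite /W' /= tpermD // (inj_eq inl_inj) xpair_eqE eq_sym (negPf ii').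
have [H HI eH] := vanishing_lift_relation
  (lift ord0 (W (inl (i, c)))) (lift ord0 (W (inr ord0))) sb.
pose P i' := if i' == i then H else block W i'.
exists ((\prod_i' P i') * R).
  apply: ideal_mulr; first exact: ideal_pow_ideal.
  by apply: ideal_pow_prod => i'; rewrite /P; case: ifP => // _; apply: block_I.
rewrite /lift_word -/W' eR eR' (bigD1 i) // [\prod_(i < m) block W i](bigD1 i) //.
rewrite [\prod_i' P i'](bigD1 i) //= {1}/P eqxx.
rewrite (eq_bigr (block W)) => [|i' ii']; last exact: eB.
rewrite [X in _ = l * (_ * X * _)](eq_bigr (block W)) => [|i' /negPf ii']; last by rewrite /P ii'.
rewrite {1}/block eW' [block W i]/block eW.
set C := \prod_(_ < _ | _) _.
have -> : l * (H * C * R) = (l * H) * (C * R) by ring.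
by rewrite -eH; ring.
Qed.

Lemma eq_lift_word W1 W2 : W1 =1 W2 -> lift_word W1 = lift_word W2.
Proof.
move=> e; congr (_ * _); last exact: eq_word.
by apply: eq_bigr => i _; congr vanishing_lift; apply: eq_word.
Qed.

Lemma lift_word_perm W t : eq_modl (lift_word (W \o t)) (lift_word W).
Proof.
pose q : X := inr ord0; have eq_lift := eq_lift_word.
have step W' p : eq_modl (lift_word (W' \o tperm p q)) (lift_word W').
  case: p => [[i c]|z]; first exact: lift_word_exchange.
  suff -> : lift_word (W' \o tperm (inr z) q) = lift_word W' by apply: eq_modl_refl.
  congr (_ * _).
    apply: eq_bigr => i _; congr vanishing_lift; apply: eq_word => c.
    by rewrite /= tpermD.
  rewrite /word [RHS](reindex_inj (@perm_inj _ (tperm z ord0))) /=.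
  apply: eq_bigr => z' _; do 3 congr (_ _); rewrite /q.
  by rewrite (inj_tperm z ord0 z' (@inr_inj _ _)).
have tpp W0 p p' : eq_modl (lift_word (W0 \o tperm p p')) (lift_word W0).
  have [->|pq] := eqVneq p q; first by rewrite tpermC; apply: step.
  have [->|p'q] := eqVneq p' q; first exact: step.
  have [<-|pp'] := eqVneq p p'.
    rewrite (eq_lift _ W0) => [|x]; first exact: eq_modl_refl.
    by rewrite /= tperm1 perm1.
  (* Conjugation expresses the transposition of [p] and [p'] by three exchanges with the pivot
     [q]. *)
  have e : W0 \o tperm p p' =1 ((W0 \o tperm p q) \o tperm p' q) \o tperm p q.
    move=> x /=; congr W0.
    case: (tpermP p p' x) => [->|->|/eqP xp /eqP xp'].
    - by rewrite tpermL [tperm p' q q]tpermR tpermD // eq_sym.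
    - by rewrite (tpermD pp') 1?eq_sym // tpermL tpermR.
    - have [->|xq] := eqVneq x q.
        by rewrite tpermR (@tpermD _ p' q p) ?tpermL // eq_sym.
      by rewrite !tpermD // eq_sym.
  rewrite (eq_lift _ _ e); apply: eq_modl_trans (step _ _).
  by apply: eq_modl_trans (step _ _); apply: step.
have [ts et _] := prod_tpermP t; rewrite et {t et}.
elim: ts W => [|[p p'] ts IHts] W.
  rewrite big_nil (eq_lift _ W) => [|x]; first exact: eq_modl_refl.
  by rewrite /= perm1.
rewrite big_cons /=; apply: eq_modl_trans (IHts W).
rewrite -(eq_lift ((W \o (\prod_(t <- ts) tperm t.1 t.2)%g) \o tperm p p')) => [|x].
  exact: tpp.
by rewrite /= permM.
Qed.

Definition word_mnm (J : finType) (w : J -> 'I_N) : 'X_{1..N.+1} :=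
  (\sum_j U_(lift ord0 (w j)))%MM.

Lemma word_mnmE (J : finType) (w : J -> 'I_N) : word w = 'X_[word_mnm w].
Proof. exact: mprodXE. Qed.

Lemma exists_word_perm (J : finType) (w w' : J -> 'I_N) :
  word_mnm w = word_mnm w' -> exists s : {perm J}, w' =1 w \o s.
Proof.
move=> e; have cnt (u : J -> 'I_N) i : count_mem i (codom u) = word_mnm u (lift ord0 i).
  rewrite mnm_sumE /codom /image_mem count_map -sum1_count big_mkcond big_enum /=.
  by apply: eq_bigr => j _; rewrite mnm1E (inj_eq lift_inj); case: eqP.
have /tuple_permP [p ep] : perm_eq (codom w') (codom_tuple w).
  by apply/allP => i _ /=; rewrite !cnt e.
pose f j := enum_val (p (enum_rank j)).
have f_inj : injective f by move=> i j /enum_val_inj /perm_inj /enum_rank_inj.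
exists (perm f_inj) => j; rewrite /= permE /f.
have := congr1 (fun s0 : seq 'I_N => nth (w j) s0 (enum_rank j)) ep.
by rewrite /= nth_image enum_rankK nth_mktuple (tnth_nth (w j)) /= nth_image.
Qed.

(** Replacing each word by a chosen word [c W] with the same monomial costs an element of [x_0 I^m].
    The coefficients collected at a chosen word then sum to a coefficient of the given relation,
    which is 0. *)
Lemma lift_words_relation (a : {ffun X -> 'I_N} -> K) :
  \sum_W a W *: word W = 0 ->
  exists2 h, ideal_pow I m h & \sum_W a W *: lift_word W = l * h.
Proof.
move=> rel; pose c (W : {ffun X -> 'I_N}) :=
  odflt W [pick W' : {ffun X -> 'I_N} | word_mnm W' == word_mnm W].
have cP (W : {ffun X -> 'I_N}) : word_mnm (c W) = word_mnm W.
  by rewrite /c; case: pickP => //= W' /eqP.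
have c_eq (W W' : {ffun X -> 'I_N}) : word_mnm W = word_mnm W' -> c W = c W'.
  move=> e; rewrite /c e; case: pickP => //= /(_ W'); by rewrite eqxx.
have [h hI eh] : eq_modl (\sum_W a W *: lift_word W) (\sum_W a W *: lift_word (c W)).
  have hI := ideal_pow_ideal I m.
  have /fin_all_exists2 [h hI' eh] (W : {ffun X -> 'I_N}) :
      exists2 h, ideal_pow I m h & lift_word W - lift_word (c W) = l * h.
    have [s es] := exists_word_perm (cP W).
    have -> : lift_word W = lift_word (c W \o s) by apply: eq_lift_word.
    exact: lift_word_perm.
  exists (\sum_W a W *: h W).
    by apply: ideal_sum => // W _; rewrite -mul_mpolyC; apply: ideal_mull.
  rewrite -sumrB mulr_sumr; apply: eq_bigr => W _.
  by rewrite -scalerBr eh scalerAr.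
exists h => //; rewrite -eh -[LHS]subr0; congr (_ - _); symmetry.
rewrite (partition_big c xpredT) //= big1 // => u _.
rewrite (eq_bigr (fun W : {ffun X -> 'I_N} => a W *: lift_word u)) => [|W /eqP -> //].
rewrite -scaler_suml.
case: (pickP (fun W : {ffun X -> 'I_N} => c W == u)) => [W0 /eqP cu|noW]; last first.
  by rewrite big_pred0 ?scale0r.
have := congr1 (mcoeff (word_mnm W0)) rel; rewrite mcoeff0 raddf_sum /= => e.
rewrite (_ : \sum_(W | _) _ = 0) ?scale0r // -[RHS]e big_mkcond /=; apply: eq_bigr => W _.
rewrite mcoeffZ word_mnmE mcoeffX.
have -> : (c W == u) = (word_mnm W == word_mnm W0).
  apply/eqP/eqP => [cW|/c_eq ->//]; by rewrite -cP cW -cu cP.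
by case: eqP; rewrite ?mulr1 ?mulr0.
Qed.

End Exchange.

(** * Generators of [I] and of its powers *)

Definition spanned (T : finType) (G : T -> A) f := exists c : T -> A, f = \sum_t c t * G t.

Lemma spanned_ideal (T : finType) (G : T -> A) : is_ideal (spanned G).
Proof.
split=> [|f g [c ->] [c' ->]|a f [c ->]].
- by exists (fun=> 0); rewrite big1 // => t _; rewrite mul0r.
- exists (fun t => c t + c' t); rewrite -big_split; apply: eq_bigr => t _.
  by rewrite mulrDl.
- exists (fun t => a * c t); rewrite mulr_sumr; apply: eq_bigr => t _.
  by rewrite mulrA.
Qed.

Lemma mem_spanned (T : finType) (G : T -> A) t : spanned G (G t).
Proof.
exists (fun t' => (t' == t)%:R); rewrite (bigD1 t) //= eqxx mul1r big1 ?addr0 //.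
by move=> t' /negPf ->; rewrite mul0r.
Qed.

Definition gen1 (w : {ffun 'I_b.+1 -> 'I_N}) : A := vanishing_lift (word w).

Lemma gen1_homog w : gen1 w \is b.+1.-homog.
Proof.
by apply: vanishing_lift_homog; rewrite -[X in X.-homog]card_ord; apply: word_homog.
Qed.

Lemma gen1_I w : I (gen1 w).
Proof.
by apply: vanishing_lift_I; rewrite -[X in X.-homog]card_ord; apply: word_homog.
Qed.

Lemma l_homog_cancel d f : l * f \is d.+1.-homog -> l * f = l * hpart d f.
Proof.
move=> h; have hl : l \is 1.-homog by rewrite dhomogX /= mdeg1.
by have := hpart_mulr d f hl; rewrite addn1 mulrC (hpart_id h) => ->; rewrite mulrC.
Qed.

(** Induction on the degree. Modulo [x_0] a form is a combination of words; lifting [b.+1] letters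
    of each gives a combination of generators, and the difference is [x_0] times a form of [I] of
    smaller degree. *)
Lemma I_spanned f : I f -> spanned gen1 f.
Proof.
move=> If; rewrite (sum_hpart f); apply: ideal_sum => [|d _]; first exact: spanned_ideal.
have := I_hpart d If; have := hpart_homog d f.
elim: (d : nat) (hpart d f) => {d f If} [|d IHd] F hF IF.
  by rewrite (I_low (leq0n b) hF IF); case: (spanned_ideal gen1).
have [ltd|led] := ltnP d b.
  by rewrite (I_low ltd hF IF); case: (spanned_ideal gen1).
pose J := ('I_b.+1 + 'I_(d - b))%type.
have cJ : #|{: J}| = d.+1 by rewrite card_sum !card_ord addSn subnKC.
have [a [g eF]] : exists (a : {ffun J -> 'I_N} -> K) g, F = \sum_w a w *: word w + l * g.
  by apply: form_decomp; rewrite cJ.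
pose wl (w : {ffun J -> 'I_N}) := [ffun x => w (inl x)].
pose wr (w : {ffun J -> 'I_N}) := [ffun x => w (inr x)].
pose F' := \sum_w a w *: (word (wr w) * gen1 (wl w)).
have F'I : I F'.
  rewrite /F'; apply: ideal_sum => [|w _]; [exact: I_ideal|rewrite -mul_mpolyC].
  by do 2 apply: (ideal_mull _ I_ideal); apply: gen1_I.
have F'S : spanned gen1 F'.
  have hS := spanned_ideal gen1; rewrite /F'; apply: ideal_sum => // w _.
  rewrite -mul_mpolyC.
  by do 2 apply: (ideal_mull _ hS); apply: mem_spanned.
have F'h : F' \is d.+1.-homog.
  rewrite /F'; apply: rpred_sum => w _; apply: rpredZ.
  have -> : d.+1 = ((d - b) + b.+1)%N by rewrite addnS subnK.
  apply: dhomogM (gen1_homog _); rewrite -[X in X.-homog]card_ord; exact: word_homog.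
have [g' eg'] : exists g', F - F' = l * g'.
  exists (g + \sum_w a w *: (word (wr w) *
    \sum_i ((word (wl w)).@[v i] / v i 0) *: S i)).
  rewrite eF mulrDr addrAC addrC; congr (_ + _).
  rewrite /F' -sumrB mulr_sumr; apply: eq_bigr => w _.
  rewrite -scalerBr -scalerAr; congr (_ *: _); rewrite /gen1 /vanishing_lift.
  have -> : word w = word (wr w) * word (wl w).
    by rewrite word_sum mulrC; congr (_ * _); apply: eq_word => x; rewrite /= ffunE.
  by rewrite mulrBr opprB addrC subrK mulrCA.
have hFF' : F - F' \is d.+1.-homog by apply: rpredB.
have eFF' : F - F' = l * hpart d g' by rewrite eg' in hFF' *; apply: l_homog_cancel.
rewrite -[F](subrK F') eFF'; have [_ SD SM] := spanned_ideal gen1; apply: SD => //.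
apply: SM; apply: IHd; first exact: hpart_homog.
by apply: I_cancel_l; rewrite -eFF'; apply: idealB I_ideal _ _.
Qed.

Definition gens m (u : {ffun 'I_m -> {ffun 'I_b.+1 -> 'I_N}}) : A :=
  \prod_i gen1 (u i).

Lemma gens_I m u : ideal_pow I m (@gens m u).
Proof. by apply: ideal_pow_prod => i; apply: gen1_I. Qed.

Lemma gens_homog m u : @gens m u \is (m * b.+1).-homog.
Proof.
rewrite /gens; elim: m u => [|m IHm] u; first by rewrite big_ord0 mul0n dhomog1.
rewrite big_ord_recl mulSn; apply: dhomogM; first exact: gen1_homog.
have := IHm [ffun i => u (lift ord0 i)].
by under eq_bigr => i _ do rewrite ffunE.
Qed.

Lemma ideal_pow_spanned m f : ideal_pow I m f -> spanned (@gens m) f.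
Proof.
elim: m f => [|m IHm] f.
  move=> _; have u0 (i : 'I_0) : {ffun 'I_b.+1 -> 'I_N} by case: i.
  have := mem_spanned (@gens 0) (finfun u0); rewrite {2}/gens big_ord0.
  by rewrite -[f]mulr1; case: (spanned_ideal (@gens 0)) => _ _; apply.
have hS := spanned_ideal (@gens m.+1).
apply: ideal_gen_min => // _ [g [h [/I_spanned [c ->] /IHm [c' ->] ->]]].
rewrite mulr_suml; apply: ideal_sum => // w _; rewrite mulr_sumr.
apply: ideal_sum => // u _; rewrite mulrACA; apply: ideal_mull => //.
have -> : gen1 w * gens u = gens [ffun i => oapp u w (unlift ord0 i)].
  rewrite /gens big_ord_recl ffunE unlift_none /=; congr (_ * _).
  by apply: eq_bigr => i _; rewrite ffunE liftK.
exact: mem_spanned.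
Qed.

Lemma ideal_pow_spanned_homog m r F : F \is (r + m * b.+1).-homog ->
  ideal_pow I m F -> exists2 c : {ffun 'I_m -> {ffun 'I_b.+1 -> 'I_N}} -> A,
    (forall u, c u \is r.-homog) & F = \sum_u c u * gens u.
Proof.
move=> hF /ideal_pow_spanned [c eF]; exists (fun u => hpart r (c u)) => [u|].
  exact: hpart_homog.
rewrite -(hpart_id hF) {1}eF raddf_sum; apply: eq_bigr => u _ /=.
exact/hpart_mulr/gens_homog.
Qed.

(** The coefficients of [l * F] have degree [r.+1], so each term has a letter outside the blocks to
    serve as pivot. *)
Lemma ideal_pow_cancel_l m r F : F \is (r + m * b.+1).-homog ->
  ideal_pow I m (l * F) -> ideal_pow I m F.
Proof.
move=> hF IlF; pose X := (('I_m * 'I_b.+1) + 'I_r.+1)%type.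
have [c hc elF] := ideal_pow_spanned_homog (mulX_homog ord0 hF : _ \is (r.+1 + _).-homog) IlF.
have hI := ideal_pow_ideal I m.
have dec u : exists ag : ({ffun 'I_r.+1 -> 'I_N} -> K) * A,
    c u = \sum_z ag.1 z *: word z + l * ag.2.
  have [|a [g e]] := @form_decomp 'I_r.+1 (c u); first by rewrite card_ord.
  by exists (a, g).
have {dec} [ag dec] := fin_all_exists dec.
pose g := \sum_u (ag u).2 * gens u.
have gI : ideal_pow I m g.
  by apply: ideal_sum => // u _; apply: ideal_mull => //; apply: gens_I.
pose us (W : {ffun X -> 'I_N}) := [ffun i => [ffun c => W (inl (i, c))]].
pose zs (W : {ffun X -> 'I_N}) := [ffun z => W (inr z)].
pose a (W : {ffun X -> 'I_N}) := (ag (us W)).1 (zs W).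
(* The multiples of [x_0] in the coefficients are collected in [g]; the other terms are lifts of
   words. *)
have eW : \sum_W a W *: lift_word W = l * (F - g).
  rewrite mulrBr elF /g mulr_sumr -sumrB.
  under [RHS]eq_bigr => u _ do rewrite dec mulrDl mulrA addrK mulr_suml.
  rewrite pair_big /= (reindex (fun W => (us W, zs W))) /=; last first.
    pose join (uz : {ffun 'I_m -> {ffun 'I_b.+1 -> 'I_N}} * {ffun 'I_r.+1 -> 'I_N}) (x : X) :=
      match x with inl ic => uz.1 ic.1 ic.2 | inr z => uz.2 z end.
    exists (fun uz => finfun (join uz)).
      by move=> W _; apply/ffunP => -[[i j]|z]; rewrite ffunE /= !ffunE.
    move=> [u z] _; congr pair; apply/ffunP => i; rewrite !ffunE //.
    by apply/ffunP => j; rewrite !ffunE.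
  apply: eq_bigr => W _; rewrite -scalerAl; congr (_ *: _); rewrite mulrC.
  congr (_ * _); last by apply: eq_word => z; rewrite ffunE.
  apply: eq_bigr => i _; rewrite /gen1 /block ffunE; congr vanishing_lift.
  by apply: eq_word => j; rewrite ffunE.
(* At [x_0 = 0] each lift becomes its word and the right side vanishes. *)
have rel : \sum_W a W *: word W = 0.
  have := congr1 setx0 eW; rewrite rmorphM /= setx0X eqxx mul0r raddf_sum /= => e.
  rewrite -[RHS]e.
  apply: eq_bigr => W _; rewrite setx0Z rmorphM rmorph_prod /= setx0_word; congr (_ *: _).
  rewrite word_sum; congr (_ * _).
  transitivity (\prod_i \prod_j ('X_(lift ord0 (W (inl (i, j)))) : A)).
    by rewrite pair_bigA /=; apply: eq_bigr => -[i j].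
  apply: eq_bigr => i _; rewrite /block /vanishing_lift rmorphB rmorphM /= setx0X eqxx mul0r subr0.
  by rewrite setx0_word.
have [h hI' eh] := lift_words_relation rel.
have : l * (F - g) = l * h by rewrite -eW.
have l0 : l != 0 by rewrite -msize_poly_eq0 msizeX.
move/(mulfI l0) => e; rewrite -[F](subrK g) e.
by case: hI => _ ID _; apply: ID.
Qed.

Lemma vord_ideal_pow_homog m r F : F \is (r + m * b.+1).-homog ->
  (forall i, vord m (v i) F) -> ideal_pow I m F.
Proof.
move=> hF /(l_pow_mul hF) [e].
elim: e => [|e IHe]; first by rewrite mul1r.
rewrite exprS -mulrA => h; apply: IHe; apply: (@ideal_pow_cancel_l m (e + r)) => //.
by rewrite -addnA dhomogM // l_exp_homog.
Qed.

Lemma homog_max_ideal_pow d F : F \is d.-homog -> ideal_pow (max_ideal K N) d F.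
Proof.
have hM := ideal_pow_ideal (max_ideal K N) d.
move=> /dhomogP hF; rewrite (mpolyE F) big_seq; apply: ideal_sum => // m /hF /= dm.
rewrite -mul_mpolyC; apply: ideal_mull => //; rewrite -dm {hF hM dm F}.
move ed: (mdeg m) => d'; elim: d' m ed => [//|d' IHd] m em.
have [i mi] : exists i, (U_(i) <= m)%MM by apply: mnm_neq0; rewrite -mdeg_eq0 em.
have e : m = (U_(i) + (m - U_(i)))%MM by rewrite addmC submK.
rewrite e mpolyXD; apply: mem_ideal_mul; first by apply: mem_ideal_gen; exists i.
by apply: IHd; move: em; rewrite {1}e mdegD mdeg1 => -[].
Qed.

Theorem symbolic_pow_containment (N_gt0 : (0 < N)%N) m :
  (0 < m)%N -> no_form (m * (b + N)).-1 (N * m) v ->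
  ideal_sub (symbolic_pow I (N * m))
    (ideal_mul (ideal_pow (max_ideal K N) (m * (N - 1))) (ideal_pow I m)).
Proof.
move=> m0 nfm f /symbolic_pow_vord ord_f.
have hJ := ideal_gen_ideal (fun h => exists f g, [/\ ideal_pow (max_ideal K N) (m * (N - 1)) f,
  ideal_pow I m g & h = f * g]).
rewrite (sum_hpart f); apply: ideal_sum => // -[d /= _] _.
have hF := hpart_homog d f.
have [ltd|led] := ltnP d (m * (b + N)).
  (* A power of [x_0] raises the degree to [m * (b + N) - 1], where the degree bound applies. *)
  suff -> : hpart d f = 0 by case: hJ.
  have hlF : l ^+ ((m * (b + N)).-1 - d) * hpart d f \is (m * (b + N)).-1.-homog.
    have dle : (d <= (m * (b + N)).-1)%N by case: (m * (b + N))%N ltd.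
    by rewrite -{2}(subnK dle) dhomogM // l_exp_homog.
  have /eqP : l ^+ ((m * (b + N)).-1 - d) * hpart d f = 0.
    by apply: nfm => // i; apply: vord_mull; apply: ord_f.
  rewrite mulf_eq0 expf_eq0 => /orP [/andP [_]|/eqP //].
  by rewrite -msize_poly_eq0 msizeX.
(* Beside [m] generators of degree [b.+1] the coefficients have degree at least [m * (N - 1)]. *)
have mbN : (m * (b + N) = m * (N - 1) + m * b.+1)%N.
  by rewrite -mulnDr; congr (_ * _)%N; lia.
have hF' : hpart d f \is (d - m * b.+1 + m * b.+1).-homog.
  by rewrite subnK // (leq_trans _ led) // mbN leq_addl.
have ordF i : vord m (v i) (hpart d f) by apply: vord_leq (ord_f d i); apply: leq_pmull.
have [c hc ->] := ideal_pow_spanned_homog hF' (vord_ideal_pow_homog hF' ordF).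
apply: ideal_sum => // u _; apply: mem_ideal_mul; last exact: gens_I.
by apply: (@ideal_pow_leq _ _ _ (d - m * b.+1)); [lia|apply/homog_max_ideal_pow/hc].
Qed.

End PointIdeal.

(** * Very general and generic points *)

Section Points.

Variables (K : fieldType) (N : nat).
Implicit Types (P : pspace K N).

Lemma hcoord_neq0 P : hcoord P != 0.
Proof. by rewrite /hcoord vpick0 -dimv_eq0 (eqP (valP P)). Qed.

Lemma hcoord_pt (v : 'rV[K]_N.+1) (hv : v != 0) :
  exists2 c, c != 0 & hcoord (pt hv) = c *: v.
Proof.
have /vlineP [c e] := memv_pick <[v]>%VS; exists c => //.
by apply: contraNneq (hcoord_neq0 (pt hv)) => c0; rewrite /hcoord /= e c0 scale0r.
Qed.

Lemma ray_scale (v w : 'I_N.+1 -> K) c (f : {mpoly K[N.+1]}) :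
  (forall i, w i = c * v i) -> ray v f = 0 -> ray w f = 0.
Proof.
move=> hw /ray_eq0 h; apply/ray_eq0 => d.
by rewrite (meval_eq _ hw) (meval_scale _ _ (hpart_homog d f)) h mulr0.
Qed.

Lemma defining_ideal_ray (X : {fset pspace K N}) f :
  defining_ideal X f <-> forall P, P \in X -> ray (hcoord P 0) f = 0.
Proof.
split=> [|h].
  apply: (@ideal_gen_min _ _ (fun g => forall P, P \in X -> ray (hcoord P 0) g = 0))
    => [|F [[d hF] FX] P PX].
    split=> [P _|g h hg hh P PX|a g hg P PX]; first exact: rmorph0.
      by rewrite rmorphD /= hg // hh // addr0.
    by rewrite rmorphM /= hg // mulr0.
  by rewrite (ray_homog _ hF) (FX P PX) scale0r.
rewrite (sum_hpart f); apply: ideal_sum => [|d _]; first exact: ideal_gen_ideal.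
apply: mem_ideal_gen; split=> [|P PX]; first by exists d; apply: hpart_homog.
by have /ray_eq0 := h P PX; apply.
Qed.

End Points.

(** * Countably many dense open conditions on cycles *)

Section Configurations.

Variables (k : fieldType) (k0 : [pchar k] =i pred0) (N b : nat) (N_gt0 : (0 < N)%N).
Local Notation n := ('C(b + N, N)).
Local Notation P := (pspace k N).

(* No form of degree [cond_deg e] vanishes to order [cond_ord e] at the points:
   for [e = 0] they impose independent conditions on forms of degree [b], for
   [e > 0] this is Chudnovsky's bound on the [N * e]-th symbolic power. *)
Definition cond_deg e := if e is 0 then b else (e * (b + N)).-1.
Definition cond_ord e := if e is 0 then 1%N else (N * e)%N.

(** Quantifying over members rather than indices makes the condition visibly symmetric, so it
    descends to cycles. *)
Definition good_tuple e (t : n.-tuple P) :=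
  (forall p, p \in t -> hcoord p 0 0 != 0) /\
  forall F : {mpoly k[N.+1]}, F \is (cond_deg e).-homog ->
    (forall p, p \in t -> vord (cond_ord e) (hcoord p 0) F) -> F = 0.

Lemma good_tuple_poly e (t : n.-tuple P) :
  good_tuple e t <->
  exists f, (condition_poly k (n := n) (d := cond_deg e) (r := cond_ord e) f)
    .@[tuple_coord t 0] != 0.
Proof.
pose z : 'M[k]_(n, N.+1) := \matrix_(i < n) hcoord (tnth t i).
have [poly_z z_poly] := condition_polyP (cond_deg e) (cond_ord e) (meval (mxvec z 0)).
rewrite map_generic_mx in poly_z z_poly.
have zE i : z i =1 hcoord (tnth t i) 0 by move=> j; rewrite mxE.
split=> [[t0 tF]|/poly_z [z0 zF]].
  apply: z_poly; split=> [i|F hF zF]; first by rewrite zE t0 // mem_tnth.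
  apply: tF => // _ /tnthP [i ->]; exact: vord_eq (zE i) (zF i).
split=> [_ /tnthP [i ->]|F hF tF]; first by rewrite -zE.
by apply: zF => // i; apply: (@vord_eq _ _ _ (hcoord (tnth t i) 0)) => [j|];
  [rewrite zE|apply/tF/mem_tnth].
Qed.

Lemma good_tuple_perm e (t t' : n.-tuple P) : perm_eq t t' -> good_tuple e t -> good_tuple e t'.
Proof.
move=> /perm_mem tt' [t0 tF]; split=> [p|F hF h]; first by rewrite -tt'; apply: t0.
by apply: tF => // p; rewrite tt'; apply: h.
Qed.

Definition good_cycle e (c : sym_prod k N n) := good_tuple e (generic_quotient.repr c).

Lemma good_cycle_of e (t : n.-tuple P) : good_cycle e (cycle_of t) <-> good_tuple e t.
Proof.
have pt' : same_cycle (generic_quotient.repr (cycle_of t)) t.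
  by apply/(@eqmodP _ (same_cycle_equiv k N n)); rewrite reprK.
by split; apply: good_tuple_perm; rewrite // perm_sym.
Qed.

Lemma open_good_cycle e : open_sym (@good_cycle e).
Proof.
exists (fun F => exists f, F = condition_poly k (n := n) (d := cond_deg e) (r := cond_ord e) f).
split=> [_ [f ->]|t].
  have [D hD] := multideg_condition_poly k f; exact: multideg_multihomog hD.
rewrite good_cycle_of good_tuple_poly; split=> [[f hf]|[_ [[f ->] hf]]]; last by exists f.
by exists (condition_poly k f); split=> //; exists f.
Qed.

(** [hcoord] returns nonzero multiples of the rows of [z], which does not affect the nonvanishing of
    multihomogeneous polynomials. *)
Lemma exists_tuple_of_mx (z : 'M[k]_(n, N.+1)) : (forall i, z i 0 != 0) ->
  exists t : n.-tuple P, forall F, multihomog F ->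
    F.@[mxvec z 0] != 0 -> F.@[tuple_coord t 0] != 0.
Proof.
move=> z0; have rz i : row i z != 0.
  by apply: contraNneq (z0 i) => /rowP /(_ 0); rewrite !mxE => ->.
have /fin_all_exists2 [c c0 ec] i := hcoord_pt (rz i).
exists [tuple pt (rz i) | i < n] => F [D hD] Fz.
have -> : tuple_coord [tuple pt (rz i) | i < n] = mxvec (\matrix_(i, j) (c i * z i j)).
  by congr mxvec; apply/matrixP => i j; rewrite !mxE tnth_mktuple ec !mxE.
rewrite (multideg_scale _ _ hD) mulf_neq0 //; apply/prodf_neq0 => i _.
by rewrite expf_neq0.
Qed.

(** One configuration serves all [e] at once; this makes the countable intersection of open sets
    nonempty. *)
Lemma good_star_mx : exists2 z : 'M[k]_(n, N.+1), forall i, z i 0 != 0 &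
  forall e, exists f,
    (condition_poly k (n := n) (d := cond_deg e) (r := cond_ord e) f).@[mxvec z 0] != 0.
Proof.
have [v [v0 v1 vm]] := star_exists b k0 N_gt0.
pose z : 'M[k]_(n, N.+1) := \matrix_(i, j) v i j; exists z => [i|e]; first by rewrite mxE.
have [_ z_poly] := condition_polyP (cond_deg e) (cond_ord e) (meval (mxvec z 0)).
apply: z_poly; rewrite map_generic_mx; split=> [i|F hF h]; first by rewrite mxE.
have {}h i : vord (cond_ord e) (v i) F.
  by apply: vord_eq (h i) => j; rewrite mxE.
by case: e hF h => [|e] hF h; [apply: v1 hF h|apply: vm hF h].
Qed.

Lemma good_star_tuple : exists t : n.-tuple P, forall e, good_tuple e t.
Proof.
have [z z0 hz] := good_star_mx; have [t ht] := exists_tuple_of_mx z0.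
exists t => e; apply/good_tuple_poly; have [f hf] := hz e; exists f; apply: ht => //.
by have [D hD] := multideg_condition_poly k f; apply: multideg_multihomog hD.
Qed.

(** Irreducibility: [F1], which witnesses that [V] is nonempty, and a condition polynomial [F2] have
    a nonzero product, so both are nonzero at some common [w]. *)
Lemma dense_good_cycle e : dense_sym (@good_cycle e).
Proof.
move=> V [S [S_homog SV]] [c Vc].
have [F1 [SF1 F1c]] : exists F, S F /\ F.@[tuple_coord (generic_quotient.repr c) 0] != 0.
  by apply/SV; rewrite /cycle_of reprK.
have [z z0 hz] := good_star_mx; have [f fz] := hz e.
set F2 := condition_poly _ _ in fz.
have [w Fw] : exists w, (F1 * F2).@[w] != 0.
  apply: NNPP => no_w; have F0 : F1 * F2 = 0.
    by apply: (meval_eq0 k0) => w; apply/eqP; apply: contraT => ?; case: no_w; exists w.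
  have /eqP := F0; rewrite mulf_eq0 => /orP [] /eqP F0'.
    by rewrite F0' meval0 eqxx in F1c.
  by rewrite F0' meval0 eqxx in fz.
pose y : 'M[k]_(n, N.+1) := \matrix_(i, j) w (mxvec_index i j).
have yw F : F.@[mxvec y 0] = F.@[w].
  by apply: meval_eq => l; case/mxvec_indexP: l => i j; rewrite mxvecE mxE.
move: Fw; rewrite mevalM mulf_eq0 negb_or -!yw => /andP [F1y F2y].
(* [F2] contains the product of the [x_0]-coordinates, so the rows of [y] define points. *)
have [y_cond _] := condition_polyP (cond_deg e) (cond_ord e) (meval (mxvec y 0)).
have [y0 _] : (forall i, y i 0 != 0) /\ no_form (cond_deg e) (cond_ord e) (fun i j => y i j).
  by rewrite map_generic_mx in y_cond; apply: y_cond; exists f.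
have [t ht] := exists_tuple_of_mx y0.
exists (cycle_of t); split.
  apply/good_cycle_of/good_tuple_poly; exists f; apply: ht => //.
  by have [D hD] := multideg_condition_poly k f; apply: multideg_multihomog hD.
by apply/SV; exists F1; split=> //; apply: ht => //; apply: S_homog.
Qed.

Definition contained (K : fieldType) (I : {mpoly K[N.+1]} -> Prop) :=
  forall m, (1 <= m)%N ->
    ideal_sub (symbolic_pow I (N * m))
      (ideal_mul (ideal_pow (max_ideal K N) (m * (N - 1))) (ideal_pow I m)).

Lemma contained_of_no_form (K : fieldType) (K0 : [pchar K] =i pred0)
    (v : 'I_n -> 'I_N.+1 -> K) (I : {mpoly K[N.+1]} -> Prop) :
  (forall i, v i 0 != 0) ->
  (forall e, no_form (cond_deg e) (cond_ord e) v) ->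
  (forall f, I f <-> forall i, ray (v i) f = 0) -> contained I.
Proof.
move=> v0 nf I_ray m m1; have [S [S_homog S_dual]] := exists_separators (nf 0%N).
apply: (symbolic_pow_containment K0 v0 (nf 0%N) S_homog S_dual I_ray N_gt0 m1).
by case: m m1 => // m _; apply: (nf m.+1).
Qed.

Lemma very_general_contained :
  holds_very_general k N n (fun X => contained (defining_ideal X)).
Proof.
exists (fun e => @good_cycle e); split=> [e||t ut ht].
- by split; [apply: open_good_cycle|apply: dense_good_cycle].
- by have [t ht] := good_star_tuple; exists (cycle_of t) => e; apply/good_cycle_of.
have {}ht e : good_tuple e t by apply/good_cycle_of.
apply: (@contained_of_no_form k k0 (fun i => hcoord (tnth t i) 0)).
- by move=> i; have [t0 _] := ht 0%N; apply: t0; apply: mem_tnth.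
- move=> e F hF h; have [_ tF] := ht e; apply: tF => // _ /tnthP [i ->]; exact: h.
move=> f; rewrite defining_ideal_ray; split=> [h i|h p].
  by apply: h; rewrite in_fset /= mem_tnth.
by rewrite in_fset /= => /tnthP [i ->].
Qed.

Lemma gen_contained : contained (gen_ideal k N n).
Proof.
have K0 : [pchar (gen_field k N n)] =i pred0.
  apply/pcharf0P => j; rewrite -(rmorph_nat (@tofrac {mpoly k[n * N.+1]})) tofrac_eq0.
  rewrite -mpolyC_nat mpolyC_eq0; have /pcharf0P := k0; exact.
have [z z0 hz] := good_star_mx.
have gen e : (forall i, @gen_coord k N n i 0 0 != 0) /\
    no_form (cond_deg e) (cond_ord e) (fun i j => @gen_coord k N n i 0 j).
  have [f fz] := hz e.
  have [h _] := condition_polyP (cond_deg e) (cond_ord e) (@tofrac {mpoly k[n * N.+1]}).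
  have [|h0 hF] := h.
    (* A polynomial with a nonzero value at the star configuration is nonzero in the field of
       fractions. *)
    exists f; rewrite tofrac_eq0; apply: contraNneq fz => ->; by rewrite meval0.
  split=> [i|F hF' Fi]; first by have := h0 i; rewrite !mxE.
  by apply: hF => // i; apply: vord_eq (Fi i) => j; rewrite !mxE.
apply: (@contained_of_no_form _ K0 (fun i => @gen_coord k N n i 0)).
- by case: (gen 0%N).
- by move=> e; case: (gen e).
move=> f; have [c c0 ec] : exists2 c, forall i, c i != 0 &
    forall i, hcoord (@gen_point k N n i) = c i *: gen_coord k N i.
  have /fin_all_exists2 := fun i => hcoord_pt (@gen_coord_neq0 k N n i); exact.
split=> h i.
  have /defining_ideal_ray /(_ _ (fset11 _)) := h i.
  apply: (ray_scale (c := (c i)^-1)) => j.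
  by rewrite ec [X in _ * X]mxE mulKf.
apply/defining_ideal_ray => p; rewrite inE => /eqP ->.
by apply: ray_scale (h i) => j; rewrite ec [LHS]mxE.
Qed.

End Configurations.

Local Close Scope ring_scope.

Theorem corollary2p9 (k : closedFieldType) (k_char0 : [pchar k]%R =i pred0)
    (N beta : nat) (N_ge1 : 1 <= N) (beta_ge1 : 1 <= beta) :
  holds_very_general k N 'C(beta + N - 1, N)
    (fun X => forall m : nat, 1 <= m ->
       ideal_sub
         (symbolic_pow (defining_ideal X) (N * m))
         (ideal_mul (ideal_pow (max_ideal k N) (m * (N - 1)))
                    (ideal_pow (defining_ideal X) m)))
  /\
  (forall m : nat, 1 <= m ->
     ideal_sub
       (symbolic_pow (gen_ideal k N 'C(beta + N - 1, N)) (N * m))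
       (ideal_mul
          (ideal_pow (max_ideal (gen_field k N 'C(beta + N - 1, N)) N)
                     (m * (N - 1)))
          (ideal_pow (gen_ideal k N 'C(beta + N - 1, N)) m))).
Proof.
case: beta beta_ge1 => [//|b] _.
have -> : b.+1 + N - 1 = b + N by rewrite addSn subn1.
by split; [apply: very_general_contained|apply: gen_contained].
Qed.
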